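(* For $\beta>1$, the sharp $\mathscr{S}^*_{\wp,n}$-radius of $\mathcal{M}_n(\beta)$ is $(2e(\beta-1)+1)^{-1/n}$.
   Context: $\mathbb{D}$ is the unit disk. For $n\ge1$, $\mathcal{A}_n$ is the class of analytic $f$ on $\mathbb{D}$ of the form $f(z)=z+\sum_{k\ge n+1}b_kz^k$, $\mathcal{A}=\mathcal{A}_1$. $f\prec g$ means $f=g\circ\omega$ for analytic $\omega:\mathbb{D}\to\mathbb{D}$, $\omega(0)=0$. $\wp(z)=1+ze^z$, $\mathscr{S}^*_\wp=\{f\in\mathcal{A}:zf'/f\prec\wp\}$, $\mathscr{S}^*_{\wp,n}=\mathcal{A}_n\cap\mathscr{S}^*_\wp$. $\mathcal{M}_n(\beta)=\{f\in\mathcal{A}_n:\operatorname{Re}(zf'(z)/f(z))<\beta\}$. For classes $G_1,G_2$, $R_{G_1}(G_2)$ is the largest $r_0\in(0,1]$ such that $r^{-1}f(rz)\in G_1$ for all $0<r\le r_0$ and all $f\in G_2$; ''sharp'' means it cannot be increased. *)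

(* Defs.v *)
From Stdlib Require Import Reals.
From Coquelicot Require Import Coquelicot.
Open Scope R_scope.

Definition cexp (z : C) : C := (exp (Re z) * cos (Im z), exp (Re z) * sin (Im z)).

Definition wp (z : C) : C := (1 + z * cexp z)%C.

Definition in_disk (z : C) : Prop := Cmod z < 1.

Definition analytic_disk (f : C -> C) : Prop :=
  exists a : nat -> C, forall z, in_disk z -> is_pseries a z (f z).

Definition class_A (n : nat) (f : C -> C) : Prop :=
  exists b : nat -> C,
    b 0%nat = 0%C /\ b 1%nat = 1%C /\
    (forall k, (2 <= k <= n)%nat -> b k = 0%C) /\
    forall z, in_disk z -> is_pseries b z (f z).

Definition subordinate (g F : C -> C) : Prop :=
  exists w : C -> C, analytic_disk w /\ w 0%C = 0%C /\
    (forall z, in_disk z -> in_disk (w z)) /\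
    forall z, in_disk z -> g z = F (w z).

(* z f'(z)/f(z), with its removable value 1 at z = 0 *)
Definition zf'f (f : C -> C) (z : C) : C :=
  if Req_EM_T (Re z) 0 then if Req_EM_T (Im z) 0 then 1%C
  else (z * C_derive f z / f z)%C else (z * C_derive f z / f z)%C.

(* f has no zeros in the punctured disk (so zf'/f is analytic on D) *)
Definition nonvanishing (f : C -> C) : Prop :=
  forall z, in_disk z -> z <> 0%C -> f z <> 0%C.

Definition S_wp_n (n : nat) (f : C -> C) : Prop :=
  class_A n f /\ nonvanishing f /\ subordinate (zf'f f) wp.

Definition M_n (n : nat) (beta : R) (f : C -> C) : Prop :=
  class_A n f /\ nonvanishing f /\
  forall z, in_disk z -> Re (zf'f f z) < beta.

Definition dilate (r : R) (f : C -> C) : C -> C :=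
  fun z => (f (RtoC r * z) / RtoC r)%C.

Definition radius_property (G1 G2 : (C -> C) -> Prop) (r0 : R) : Prop :=
  forall r, 0 < r <= r0 -> forall f, G2 f -> G1 (dilate r f).

Definition is_sharp_radius (G1 G2 : (C -> C) -> Prop) (r0 : R) : Prop :=
  0 < r0 <= 1 /\ radius_property G1 G2 r0 /\
  forall r1, r0 < r1 <= 1 -> ~ radius_property G1 G2 r1.

(* Main.v *)
Require Import Defs.
From Stdlib Require Import Reals Lra Lia IndefiniteDescription ssreflect.
From Coquelicot Require Import Coquelicot.
Open Scope R_scope.

(** Write [z f'/f = 1 + h] with [h = z^n k(z)] and [B = beta - 1]. Since [Re h < B], the function
    [h / (h - 2 B)] maps the disk to itself and vanishes to order [n] at 0, so Schwarz's lemma gives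
    [|h| (1 - |z|^n) <= 2 B |z|^n]; hence [|h (r z)| < 1/e] as soon as [r^n (2 e B + 1) <= 1].
    On [|y| < 1/e] the equation [w e^w = y] has a unique solution [W y] in the unit disk (the fixed
    point of the contraction [w |-> y e^{-w}]), holomorphic in [y], and [W (h (r z))] is the
    subordinating function. For sharpness, [f = z (1 - z^n)^{2 B / n}] gives
    [h = - 2 B z^n / (1 - z^n)], which takes real values below [-1/e] on the positive radius once
    [|z|^n (2 e B + 1) > 1], whereas a real value of [w e^w] with [|w| < 1] exceeds [-1/e].

    The analyticity of [W o h] and of the extremal function rests on Taylor's theorem for C^1
    holomorphic functions, obtained from Cauchy's formula:
    the integral of [F (z + l (zeta - z)) zeta / (zeta - z)] over the circle does not depend on [l]. *)

(** * Continuity and complex derivatives *)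

(** Origin of the constant: [-1/e] is the value of [w e^w] at its critical point [w = -1], and
    [|w e^w| >= 1/e] on the unit circle, so [|y| < 1/e] is the largest centred disk covered by
    [wp - 1]. The bound [2 B x / (1 - x)] with [x = |r z|^n] reaches [1/e] exactly at
    [x = 1 / (2 e B + 1)]. The extremal [h] attains that bound with a negative real value, in the
    direction of the nearest uncovered point [-1/e], so the two estimates combine without loss. The
    quotient [h / (h - 2 B)] appears because [2 B] is the mirror image of 0 in the line [Re = B].
    The obstacle is that [subordinate] asks for a power series of the inner function, while [W] is
    only known as a fixed point selected for each [y]; the expansion has to be extracted from its
    complex derivative. The homotopy in [l] is used twice for this: it shrinks a circle to a point
    (Cauchy's formula) and it changes the radius of a circle (coefficients independent of the
    radius). Cauchy's formula for powers of a function also yields the maximum principle behind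
    Schwarz's lemma. *)

Ltac cfold :=
  repeat match goal with x : UniformSpace.sort C_UniformSpace |- _ => change C in x end;
  match goal with |- @eq _ ?a ?b => change (@eq C a b) end.
Ltac cring := cfold; ring.
Ltac cfield := cfold; field.

Section Continuity.
Context {U : UniformSpace}.
Implicit Types (u v : U -> C) (x : U).

Lemma continuous_C_pair (f g : U -> R) x :
  continuous f x -> continuous g x ->
  continuous (fun y => (f y, g y) : C) x.
Proof.
move=> Hf Hg.
apply: (filterlim_comp_2 f g pair Hf Hg).
by move=> P [e He]; exists (fun a => ball (f x) e a) (fun b => ball (g x) e b);
  try (by exists e); move=> a b Ha Hb; apply: He.
Qed.

Lemma continuous_Re u x : continuous u x -> continuous (fun y => fst (u y)) x.
Proof. move=> Hu; apply: (continuous_comp u fst) => //; exact: continuous_fst. Qed.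

Lemma continuous_Im u x : continuous u x -> continuous (fun y => snd (u y)) x.
Proof. move=> Hu; apply: (continuous_comp u snd) => //; exact: continuous_snd. Qed.

Lemma continuous_Cplus u v x : continuous u x -> continuous v x ->
  continuous (fun y => (u y + v y)%C) x.
Proof.
move=> Hu Hv; apply: continuous_C_pair; apply: (continuous_plus (V := R_NormedModule));
  solve [exact: continuous_Re | exact: continuous_Im].
Qed.

Lemma continuous_Copp u x : continuous u x -> continuous (fun y => (- u y)%C) x.
Proof.
move=> Hu; apply: continuous_C_pair; apply: (continuous_opp (V := R_NormedModule));
  solve [exact: continuous_Re | exact: continuous_Im].
Qed.

Lemma continuous_Cminus u v x : continuous u x -> continuous v x ->
  continuous (fun y => (u y - v y)%C) x.
Proof. by move=> Hu Hv; apply: continuous_Cplus => //; apply: continuous_Copp. Qed.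

Lemma continuous_Cmult u v x : continuous u x -> continuous v x ->
  continuous (fun y => (u y * v y)%C) x.
Proof.
move=> Hu Hv; apply: continuous_C_pair;
  [apply: (continuous_minus (V := R_NormedModule)) | apply: (continuous_plus (V := R_NormedModule))];
  apply: (continuous_mult (K := R_AbsRing));
  solve [exact: continuous_Re | exact: continuous_Im].
Qed.

Lemma continuous_Rinv_comp (f : U -> R) x : continuous f x -> f x <> 0 ->
  continuous (fun y => / f y) x.
Proof.
move=> Hf H0; apply: (continuous_comp f Rinv) => //.
exact: continuous_Rinv.
Qed.

Lemma continuous_Cinv u x : continuous u x -> u x <> 0%C ->
  continuous (fun y => (/ u y)%C) x.
Proof.
move=> Hu H0.
have Hn : fst (u x) ^ 2 + snd (u x) ^ 2 <> 0.
{ move=> H; apply: H0; apply: injective_projections => /=; nra. }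
have Hs : continuous (fun y => fst (u y) ^ 2 + snd (u y) ^ 2) x.
{ apply: (continuous_plus (V := R_NormedModule)) => /=;
  apply: (continuous_mult (K := R_AbsRing));
  try apply: (continuous_mult (K := R_AbsRing));
  solve [exact: continuous_Re | exact: continuous_Im | exact: continuous_const]. }
apply: continuous_C_pair; apply: (continuous_mult (K := R_AbsRing));
  solve [exact: continuous_Re | apply: continuous_Rinv_comp; [exact: Hs | exact: Hn]
  | apply: (continuous_opp (V := R_NormedModule)); exact: continuous_Im].
Qed.

Lemma continuous_cexp u x : continuous u x -> continuous (fun y => cexp (u y)) x.
Proof.
move=> Hu; apply: continuous_C_pair; apply: (continuous_mult (K := R_AbsRing)).
- apply: (continuous_comp (fun y => fst (u y)) exp); [exact: continuous_Re | exact: continuous_exp].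
- apply: (continuous_comp (fun y => snd (u y)) cos); [exact: continuous_Im | exact: continuous_cos].
- apply: (continuous_comp (fun y => fst (u y)) exp); [exact: continuous_Re | exact: continuous_exp].
- apply: (continuous_comp (fun y => snd (u y)) sin); [exact: continuous_Im | exact: continuous_sin].
Qed.

Lemma continuous_Cpow u n x : continuous u x -> continuous (fun y => (u y ^ n)%C) x.
Proof.
move=> Hu; elim: n => [|n IH] /=; first exact: continuous_const.
exact: continuous_Cmult.
Qed.

Lemma continuous_RtoC (f : U -> R) x : continuous f x -> continuous (fun y => RtoC (f y)) x.
Proof. move=> Hf; apply: continuous_C_pair => //; exact: continuous_const. Qed.

End Continuity.

Lemma C_ball_Cmod (x y : C) e : Cmod (y - x) < e -> ball (M := C_UniformSpace) x e y.
Proof.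
move=> H; have := Rmax_Cmod (y - x)%C => Hm.
have := Rmax_l (Rabs (fst (y - x)%C)) (Rabs (snd (y - x)%C)).
have := Rmax_r (Rabs (fst (y - x)%C)) (Rabs (snd (y - x)%C)).
by split; rewrite /ball /= /AbsRing_ball /abs /minus /plus /opp /=; simpl in *; lra.
Qed.

Lemma locally_C_Cmod (z : C) (P : C -> Prop) :
  locally (T := C_UniformSpace) z P <-> exists d, 0 < d /\ forall x, Cmod (x - z) < d -> P x.
Proof.
split.
- move=> [d Hd]; exists d; split; first exact: cond_pos.
  by move=> x Hx; apply: Hd; apply: C_ball_Cmod.
- move=> [d [Hd H]].
  (* Half of [d] is small enough: the modulus is at most [sqrt 2] times the larger coordinate, and
     [sqrt 2 < 2]. *)
  have Hd2 : 0 < d / 2 by lra.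
  exists (mkposreal _ Hd2) => x [H1 H2]; apply: H.
  apply: Rle_lt_trans (Cmod_2Rmax _) _.
  have Hs : sqrt 2 < 2.
  { have := sqrt_lt_1 2 4 ltac:(lra) ltac:(lra) ltac:(lra).
    by rewrite (_ : 4 = 2 ^ 2); [rewrite sqrt_pow2; lra | lra]. }
  have Hs0 := sqrt_pos 2.
  rewrite /ball /= /AbsRing_ball /abs /minus /plus /opp /= in H1 H2.
  have : Rmax (Rabs (fst (x - z)%C)) (Rabs (snd (x - z)%C)) < d / 2 by apply: Rmax_lub_lt.
  have := Rmax_l (Rabs (fst (x - z)%C)) (Rabs (snd (x - z)%C)).
  have := Rabs_pos (fst (x - z)%C).
  nra.
Qed.

Lemma continuous_C_Cmod (F : C -> C) (z : C) :
  continuous F z <->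
  forall e, 0 < e -> exists d, 0 < d /\ forall x, Cmod (x - z) < d -> Cmod (F x - F z) < e.
Proof.
split.
- move=> H e He; apply/(locally_C_Cmod z (fun x => Cmod (F x - F z) < e)).
  apply: (H (fun y => Cmod (y - F z) < e)).
  by apply/locally_C_Cmod; exists e.
- move=> H P /locally_C_Cmod [e [He HP]].
  have [d [Hd HF]] := H e He.
  by apply/locally_C_Cmod; exists d; split => // x Hx; apply: HP; apply: HF.
Qed.

(* Caratheodory's form of differentiability: a slope function continuous at the point. *)
Definition cderiv (F : C -> C) (z l : C) : Prop :=
  exists Phi : C -> C, continuous Phi z /\ Phi z = l /\
    locally (T := C_UniformSpace) z (fun x => F x = F z + Phi x * (x - z))%C.

Lemma cderiv_continuous F z l : cderiv F z l -> continuous F z.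
Proof.
move=> [Phi [Hc [_ Hl]]].
apply: (continuous_ext_loc _ (fun x => F z + Phi x * (x - z))%C).
- by apply: filter_imp Hl => x ->.
- apply: continuous_Cplus; first exact: continuous_const.
  apply: continuous_Cmult => //; apply: continuous_Cminus; [exact: continuous_id | exact: continuous_const].
Qed.

Lemma cderiv_ext_loc F G z l :
  locally (T := C_UniformSpace) z (fun x => F x = G x) -> cderiv F z l -> cderiv G z l.
Proof.
move=> HE [Phi [Hc [Hz Hl]]]; exists Phi; split => //; split => //.
have E := locally_singleton _ _ HE.
apply: filter_imp (filter_and _ _ HE Hl) => x [<- ->]; by rewrite E.
Qed.

Lemma cderiv_const c z : cderiv (fun _ => c) z 0.
Proof.
exists (fun _ => 0%C); split; first exact: continuous_const.
split => //; apply: filter_forall => x; cring.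
Qed.

Lemma cderiv_id z : cderiv (fun x => x) z 1.
Proof.
exists (fun _ => 1%C); split; first exact: continuous_const.
split => //; apply: filter_forall => x; cring.
Qed.

Lemma cderiv_plus F G z l m : cderiv F z l -> cderiv G z m ->
  cderiv (fun x => F x + G x)%C z (l + m).
Proof.
move=> [P [Pc [Pz Pl]]] [Q [Qc [Qz Ql]]].
exists (fun x => P x + Q x)%C; split; first exact: continuous_Cplus.
split; first by rewrite Pz Qz.
apply: filter_imp (filter_and _ _ Pl Ql) => x [-> ->]; cring.
Qed.

Lemma cderiv_mult F G z l m : cderiv F z l -> cderiv G z m ->
  cderiv (fun x => F x * G x)%C z (l * G z + F z * m).
Proof.
move=> HF HG; have GC := cderiv_continuous _ _ _ HG.
move: HF HG => [P [Pc [Pz Pl]]] [Q [Qc [Qz Ql]]].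
exists (fun x => P x * G x + F z * Q x)%C; split.
{ apply: continuous_Cplus; apply: continuous_Cmult => //; exact: continuous_const. }
split; first by rewrite Pz Qz.
apply: filter_imp (filter_and _ _ Pl Ql) => x [-> ->]; cring.
Qed.

Lemma cderiv_scal c F z l : cderiv F z l -> cderiv (fun x => c * F x)%C z (c * l).
Proof.
move=> H; have := cderiv_mult _ _ _ _ _ (cderiv_const c z) H.
by rewrite (_ : 0 * F z + c * l = c * l)%C; last cring.
Qed.

Lemma locally_neq0 (F : C -> C) z : continuous F z -> F z <> 0%C ->
  locally (T := C_UniformSpace) z (fun x => F x <> 0%C).
Proof.
move=> HF H0; have Hp := proj1 (Cmod_gt_0 _) H0.
have [d [Hd H]] := proj1 (continuous_C_Cmod F z) HF _ Hp.
apply/locally_C_Cmod; exists d; split => // x /H Hx E.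
rewrite E in Hx; have : (0 - F z = - F z)%C by cring.
move=> E2; rewrite E2 Cmod_opp in Hx; lra.
Qed.

Lemma cderiv_inv F z l : cderiv F z l -> F z <> 0%C ->
  cderiv (fun x => / F x)%C z (- l / (F z * F z)).
Proof.
move=> HF H0; have FC := cderiv_continuous _ _ _ HF.
have FN := locally_neq0 _ _ FC H0.
move: HF => [P [Pc [Pz Pl]]].
exists (fun x => - P x * / (F x * F z))%C; split.
{ apply: continuous_Cmult; first exact: continuous_Copp.
  apply: continuous_Cinv; last exact: Cmult_neq_0.
  apply: continuous_Cmult => //; exact: continuous_const. }
split; first by rewrite Pz.
apply: filter_imp (filter_and _ _ Pl FN) => x [E N].
have -> : (- P x * / (F x * F z) * (x - z) = - (P x * (x - z)) * / (F x * F z))%C by cring.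
have -> : (P x * (x - z) = F x - F z)%C by rewrite E; cring.
by cfield.
Qed.

Lemma cderiv_comp G F z l m : cderiv G (F z) m -> cderiv F z l ->
  cderiv (fun x => G (F x)) z (m * l).
Proof.
move=> HG HF; have FC := cderiv_continuous _ _ _ HF.
move: HF HG => [P [Pc [Pz Pl]]] [Q [Qc [Qz Ql]]].
exists (fun x => Q (F x) * P x)%C; split.
{ apply: continuous_Cmult => //; exact: (continuous_comp F Q). }
split; first by rewrite Pz Qz.
have FL := FC _ Ql.
apply: filter_imp (filter_and _ _ Pl FL) => x [E1 E2].
rewrite E2 {2}E1; cring.
Qed.

Lemma cderiv_pow n z : cderiv (fun x => x ^ S n)%C z (RtoC (INR (S n)) * z ^ n).
Proof.
elim: n => [|n IH].
- have -> : (RtoC (INR 1) * z ^ 0 = 1)%C by simpl; cring.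
  apply: (cderiv_ext_loc (fun x => x)); last exact: cderiv_id.
  by apply: filter_forall => x /=; cring.
- have := cderiv_mult _ _ _ _ _ (cderiv_id z) IH.
  have -> : (1 * z ^ S n + z * (RtoC (INR (S n)) * z ^ n) = RtoC (INR (S (S n))) * z ^ S n)%C.
  { rewrite (S_INR (S n)) RtoC_plus /=; ring. }
  done.
Qed.

(** The slope function is the difference quotient, completed by [l] at [z]; the case split is on the
    real number [Cmod (x - z)], where equality is decidable. *)
Lemma cderiv_of_little_o F z l :
  (forall e, 0 < e -> exists d, 0 < d /\ forall x, Cmod (x - z) < d ->
     Cmod (F x - F z - l * (x - z)) <= e * Cmod (x - z)) ->
  cderiv F z l.
Proof.
move=> H.
exists (fun x => if Req_EM_T (Cmod (x - z)) 0 is left _ then l else (F x - F z) / (x - z))%C.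
have Hzz : Cmod (z - z)%C = 0 by rewrite (_ : (z - z = 0)%C); [exact: Cmod_0 | cring].
have Hz : (if Req_EM_T (Cmod (z - z)) 0 is left _ then l else ((F z - F z) / (z - z))%C) = l.
{ by case: Req_EM_T. }
split.
- apply/continuous_C_Cmod => e He; rewrite Hz.
  have [d [Hd Hx]] := H (e / 2) ltac:(lra).
  exists d; split => // x xd; case: Req_EM_T => [E|N].
  + rewrite (_ : (l - l = 0)%C); [rewrite Cmod_0; lra | cring].
  + have N' : (x - z <> 0)%C by move=> E; apply: N; rewrite E Cmod_0.
    have -> : ((F x - F z) / (x - z) - l = (F x - F z - l * (x - z)) / (x - z))%C by cfield.
    rewrite Cmod_div //.
    have Hp := proj1 (Cmod_gt_0 _) N'.
    apply: (Rle_lt_trans _ (e / 2)); last lra.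
    apply/Rle_div_l => //; exact: Hx.
- split => //; apply: filter_forall => x; case: Req_EM_T => [E|N].
  + have E' := Cmod_eq_0 _ E.
    have -> : x = z by rewrite (_ : x = x - z + z)%C; [rewrite E'; cring | cring].
    cring.
  + have N' : (x - z <> 0)%C by move=> E; apply: N; rewrite E Cmod_0.
    by cfield.
Qed.

Lemma Cmod_pair_le (a b : R) : Cmod (a, b) <= Rabs a + Rabs b.
Proof.
have -> : (a, b) = (RtoC a + RtoC b * Ci)%C by apply: injective_projections => /=; ring.
apply: Rle_trans (Cmod_triangle _ _) _.
rewrite Cmod_mult !Cmod_R Cmod_Ci; lra.
Qed.

(** Bridge to the real derivative: it imports [exp], [cos] and [sin] into the slope form and exports
    real parts of complex curves to the real integration theorems. *)
Lemma is_derive_slope (f : R -> R) x l :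
  is_derive f x l <-> exists phi : R -> R, continuous phi x /\ phi x = l /\
    locally x (fun y => f y = f x + phi y * (y - x)).
Proof.
split.
- move=> /is_derive_Reals H.
  exists (fun y => if Req_EM_T y x is left _ then l else (f y - f x) / (y - x)).
  have Hx : (if Req_EM_T x x is left _ then l else (f x - f x) / (x - x)) = l by case: Req_EM_T.
  split.
  + apply/continuity_pt_filterlim => e He; have [d Hd] := H e He.
    exists d; split; first exact: cond_pos.
    move=> y [_ Hy]; rewrite /dist /= /Rdist in Hy *; rewrite Hx.
    case: Req_EM_T => [E|N]; first by rewrite Rminus_diag Rabs_R0.
    have := Hd (y - x) ltac:(lra) Hy.
    by rewrite (_ : x + (y - x) = y); last lra.
  + split => //; apply: filter_forall => y; case: Req_EM_T => [->|N]; first by lra.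
    field; lra.
- move=> [phi [Hc [Hx Hl]]].
  apply/is_derive_Reals => e He.
  have /continuity_pt_filterlim Hc' := Hc.
  have [d1 [Hd1 H1]] := Hc' e He.
  move: Hl => [d2 H2].
  have Hd : 0 < Rmin d1 d2 by apply: Rmin_pos => //; exact: cond_pos.
  exists (mkposreal _ Hd) => h Hh /= Hhd.
  have L1 := Rmin_l d1 d2; have L2 := Rmin_r d1 d2.
  rewrite H2; last by rewrite /ball /= /AbsRing_ball /abs /minus /plus /opp /=;
     rewrite (_ : x + h + - x = h); lra.
  rewrite (_ : (f x + phi (x + h) * (x + h - x) - f x) / h - l = phi (x + h) - phi x);
    last by rewrite Hx; field.
  have := H1 (x + h); rewrite /dist /= /Rdist; apply; split.
  + split => //; lra.
  + rewrite (_ : x + h - x = h); lra.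
Qed.

(** * The complex exponential and its derivative *)

Lemma cexp_plus z w : cexp (z + w) = (cexp z * cexp w)%C.
Proof.
rewrite /cexp /Re /Im; case: z => a b; case: w => c d /=.
rewrite exp_plus cos_plus sin_plus.
apply: injective_projections => /=; ring.
Qed.

Lemma Cmod_cexp z : Cmod (cexp z) = exp (fst z).
Proof.
have := Cmod2_alt (cexp z); rewrite /cexp /Re /Im /= => H.
have E := sin2_cos2 (snd z); rewrite /Rsqr in E.
have Hp := exp_pos (fst z); have Hm := Cmod_ge_0 (exp (fst z) * cos (snd z), exp (fst z) * sin (snd z)).
set m := Cmod _ in H Hm *; set x := exp _ in H Hp *.
have : m * m = x * x by nra.
move=> E2; nra.
Qed.

Lemma cexp_neq0 z : cexp z <> 0%C.
Proof. by apply/Cmod_gt_0; rewrite Cmod_cexp; exact: exp_pos. Qed.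

Lemma cexp_0 : cexp 0 = 1%C.
Proof. by rewrite /cexp /= exp_0 cos_0 sin_0; apply: injective_projections => /=; ring. Qed.

(** The slopes of [exp], [cos] and [sin] at the real point 0 suffice here; [cexp_plus] then carries
    the derivative to every other point. *)
Lemma cderiv_cexp_0 : cderiv cexp 0 1.
Proof.
have [E [Ec [E0 El]]] := proj1 (is_derive_slope _ _ _) (is_derive_exp 0).
have [K [Kc [K0 Kl]]] := proj1 (is_derive_slope _ _ _) (is_derive_cos 0).
have [S [Sc [S0 Sl]]] := proj1 (is_derive_slope _ _ _) (is_derive_sin 0).
have Cr : continuous (fun h : C => fst h) (0%C : C) by exact: continuous_fst.
have Ci' : continuous (fun h : C => snd h) (0%C : C) by exact: continuous_snd.
(* cexp h - 1 = Re h * P h + Im h * Q h with P 0 = 1 and Q 0 = i *)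
pose P := fun h : C => (E (fst h) * cos (snd h), 0) : C.
pose Q := fun h : C => (K (snd h), exp (fst h) * S (snd h)) : C.
have Pc : continuous P (0%C : C).
{ apply: continuous_C_pair; last exact: continuous_const.
  apply: (continuous_mult (K := R_AbsRing)).
  - exact: (continuous_comp (fun h : C => fst h) E).
  - by apply: (continuous_comp (fun h : C => snd h) cos) => //; exact: continuous_cos. }
have Qc : continuous Q (0%C : C).
{ apply: continuous_C_pair; first exact: (continuous_comp (fun h : C => snd h) K).
  apply: (continuous_mult (K := R_AbsRing)).
  - by apply: (continuous_comp (fun h : C => fst h) exp) => //; exact: continuous_exp.
  - exact: (continuous_comp (fun h : C => snd h) S). }
have P0 : P 0%C = 1%C.
{ rewrite /P /= E0 cos_0 exp_0; apply: injective_projections => /=; ring. }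
have Q0 : Q 0%C = Ci.
{ rewrite /Q /= K0 S0 sin_0 cos_0 exp_0; apply: injective_projections => /=; ring. }
apply: cderiv_of_little_o => e He.
have [d1 [Hd1 H1]] := proj1 (continuous_C_Cmod P 0%C) Pc (e / 2) ltac:(lra).
have [d2 [Hd2 H2]] := proj1 (continuous_C_Cmod Q 0%C) Qc (e / 2) ltac:(lra).
have HE : locally (T := C_UniformSpace) (0%C : C)
  (fun h : C => exp (fst h) = exp 0 + E (fst h) * (fst h - 0)) := Cr _ El.
have HK : locally (T := C_UniformSpace) (0%C : C)
  (fun h : C => cos (snd h) = cos 0 + K (snd h) * (snd h - 0)) := Ci' _ Kl.
have HS : locally (T := C_UniformSpace) (0%C : C)
  (fun h : C => sin (snd h) = sin 0 + S (snd h) * (snd h - 0)) := Ci' _ Sl.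
have [d3 [Hd3 H3]] := proj1 (locally_C_Cmod _ _) (filter_and _ _ HE (filter_and _ _ HK HS)).
exists (Rmin d1 (Rmin d2 d3)); split; first by do 2 (apply: Rmin_pos => //).
move=> h Hh.
have M1 := Rmin_l d1 (Rmin d2 d3); have M2 := Rmin_r d1 (Rmin d2 d3).
have M3 := Rmin_l d2 d3; have M4 := Rmin_r d2 d3.
have [X1 [X2 X3]] := H3 h ltac:(lra).
have {}H1 := H1 h ltac:(lra); have {}H2 := H2 h ltac:(lra).
rewrite P0 in H1; rewrite Q0 in H2.
have -> : (cexp h - cexp 0 - 1 * (h - 0) = RtoC (fst h) * (P h - 1) + RtoC (snd h) * (Q h - Ci))%C.
{ rewrite cexp_0 /cexp /P /Q /Re /Im X1 X2 X3 exp_0 sin_0 cos_0.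
  apply: injective_projections => /=; ring. }
have -> : (h - 0)%C = h by cring.
apply: Rle_trans (Cmod_triangle _ _) _; rewrite !Cmod_mult !Cmod_R.
have B1 := Rmax_Cmod h.
have B2 := Rmax_l (Rabs (fst h)) (Rabs (snd h)).
have B3 := Rmax_r (Rabs (fst h)) (Rabs (snd h)).
have Y1 := Rabs_pos (fst h); have Y2 := Rabs_pos (snd h).
nra.
Qed.

Lemma cderiv_cexp z : cderiv cexp z (cexp z).
Proof.
have H : cderiv (fun x => cexp z * cexp (x + - z))%C z (cexp z * (1 * (1 + 0)))%C.
{ apply: cderiv_scal; apply: (cderiv_comp cexp (fun x => x + - z)%C).
  - rewrite (_ : (z + - z = 0)%C); [exact: cderiv_cexp_0 | cring].
  - apply: cderiv_plus; [exact: cderiv_id | exact: cderiv_const]. }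
rewrite (_ : (cexp z * (1 * (1 + 0)) = cexp z)%C) in H; last cring.
apply: cderiv_ext_loc H; apply: filter_forall => x.
rewrite -cexp_plus; congr cexp; cring.
Qed.

(** [C_derive] is a coordinatewise limit along the horizontal line through [z] only, so a genuine
    complex derivative determines it. This links the definition of [zf'f] to [cderiv]. *)
Lemma cderiv_C_derive F z l : cderiv F z l -> C_derive F z = l.
Proof.
move=> [Phi [Pc [<- Pl]]].
have Lz : filterlim (fun x : R => (x, snd z) : C) (locally (fst z)) (locally (T := C_UniformSpace) z).
{ have : @continuous R_UniformSpace C_UniformSpace (fun x : R => (x, snd z) : C) (fst z)
    by apply: continuous_C_pair; [exact: continuous_id | exact: continuous_const].
  by rewrite /continuous -surjective_pairing. }
have HL := Lz _ Pl.
have Hs : Rbar_locally' (fst z)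
   (fun x => Phi (x, snd z) = ((F (x, snd z) - F z) / ((x, snd z) - z))%C).
{ move: HL; rewrite /filtermap => -[d Hd]; exists d => x Hx Nx.
  rewrite (Hd x Hx); field => E; apply: Nx.
  have := f_equal fst E => /=; lra. }
have HP := filterlim_comp _ _ _ _ _ _ _ _ Lz Pc.
rewrite /C_derive /C_lim [Phi z]surjective_pairing.
have HQ : forall p : C -> R, (forall y : C, @continuous C_UniformSpace R_UniformSpace p y) ->
  real (Lim (fun x => p ((F (x, snd z) - F z) / ((x, snd z) - z))%C) (fst z)) = p (Phi z).
{ move=> p Hp; rewrite (is_lim_unique _ _ (Finite (p (Phi z)))) //.
  apply: (filterlim_ext_loc (fun x => p (Phi (x, snd z)))).
  { by apply: filter_imp Hs => x <-. }
  apply: (filterlim_filter_le_1 (F := locally (fst z)) (G := Rbar_locally' (fst z))).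
  { move=> Q [d Hd]; exists d => x Hx _; exact: Hd. }
  apply: filterlim_comp HP _; exact: Hp. }
by congr pair; apply: HQ => y; [exact: continuous_fst | exact: continuous_snd].
Qed.

(** * Power series *)

Notation is_Cseries := (is_series (K := C_AbsRing) (V := C_NormedModule)).
Notation is_Cpseries := (is_pseries (K := C_AbsRing) (V := C_NormedModule)).

Lemma pow_n_C (z : C) k : pow_n (K := C_Ring) z k = (z ^ k)%C.
Proof. by elim: k => [|k IH] //=; rewrite -IH. Qed.

Lemma is_Cseries_Cmod (a : nat -> C) (l : C) :
  is_Cseries a l <->
  forall e, 0 < e -> exists N, forall n, (N <= n)%nat -> Cmod (sum_n (G := C_AbelianMonoid) a n - l) < e.
Proof.
split.
- move=> H e He.
  by apply: (H (fun y : C => Cmod (y - l) < e)); apply/locally_C_Cmod; exists e.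
- move=> H P /locally_C_Cmod [e [He HP]]; have [N HN] := H e He.
  exists N => n Hn; exact: HP (HN n Hn).
Qed.

Lemma is_Cseries_fst (a : nat -> C) (l : C) : is_Cseries a l -> is_series (fun k => fst (a k)) (fst l).
Proof.
move=> H; have := filterlim_comp _ _ _ _ fst _ _ _ H (continuous_Re (fun y : C => y) l (continuous_id l)).
apply: filterlim_ext => n; elim: n => [|n IH]; first by rewrite !sum_O.
by rewrite !sum_Sn -IH.
Qed.

Lemma is_Cseries_snd (a : nat -> C) (l : C) : is_Cseries a l -> is_series (fun k => snd (a k)) (snd l).
Proof.
move=> H; have := filterlim_comp _ _ _ _ snd _ _ _ H (continuous_Im (fun y : C => y) l (continuous_id l)).
apply: filterlim_ext => n; elim: n => [|n IH]; first by rewrite !sum_O.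
by rewrite !sum_Sn -IH.
Qed.

Lemma is_Cseries_unique (a : nat -> C) (l m : C) : is_Cseries a l -> is_Cseries a m -> l = m.
Proof.
move=> Ha Hm; apply: injective_projections.
- by rewrite -(is_series_unique _ _ (is_Cseries_fst _ _ Ha)) -(is_series_unique _ _ (is_Cseries_fst _ _ Hm)).
- by rewrite -(is_series_unique _ _ (is_Cseries_snd _ _ Ha)) -(is_series_unique _ _ (is_Cseries_snd _ _ Hm)).
Qed.

Lemma is_Cseries_Cmod_le (a : nat -> C) (b : nat -> R) (l : C) (S : R) :
  (forall k, Cmod (a k) <= b k) -> is_Cseries a l -> is_series b S -> Cmod l <= S.
Proof.
move=> Hab Ha Hb.
apply: Rnot_lt_le => Hlt.
have [N1 H1] := proj1 (is_Cseries_Cmod a l) Ha ((Cmod l - S) / 2) ltac:(lra).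
have He : 0 < (Cmod l - S) / 2 by lra.
have [N2 H2] : exists N, forall n, (N <= n)%nat -> Rabs (sum_n b n - S) < (Cmod l - S) / 2.
{ apply: (Hb (fun y => Rabs (y - S) < (Cmod l - S) / 2)). by exists (mkposreal _ He). }
have {}H1 := H1 (max N1 N2) ltac:(lia); have {}H2 := H2 (max N1 N2) ltac:(lia).
set n := max N1 N2 in H1 H2.
have Hs : Cmod (sum_n (G := C_AbelianMonoid) a n) <= sum_n b n.
{ elim: n {H1 H2} => [|n IH]; first by rewrite !sum_O.
  rewrite !sum_Sn; apply: Rle_trans (Cmod_triangle _ _) _.
  exact: Rplus_le_compat. }
have H2' := Rabs_def2 _ _ H2.
have : Cmod l <= Cmod (sum_n (G := C_AbelianMonoid) a n) + Cmod (sum_n (G := C_AbelianMonoid) a n - l).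
{ rewrite -(Cmod_opp (_ - l)); set s := sum_n _ _.
  rewrite {1}(_ : l = s + - (s - l))%C; [exact: Cmod_triangle | cring]. }
lra.
Qed.

Lemma ex_Cseries_le (a : nat -> C) (b : nat -> R) :
  (forall k, Cmod (a k) <= b k) -> ex_series b -> exists l : C, is_Cseries a l.
Proof.
move=> Hab Hb.
by have [l Hl] := ex_series_le (K := C_AbsRing) (V := C_CompleteNormedModule) a b Hab Hb; exists l.
Qed.

(** Built from the real [Series], hence total; its value is meaningful only where the power series
    converges. *)
Definition psum (a : nat -> C) (z : C) : C :=
  (Series (fun k => fst (a k * z ^ k)%C), Series (fun k => snd (a k * z ^ k)%C)).

Lemma is_Cpseries_mult (a : nat -> C) (z l : C) : is_Cpseries a z l <-> is_Cseries (fun k => (a k * z ^ k)%C) l.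
Proof.
by split; apply: is_series_ext => k; rewrite pow_n_C; cfold; rewrite /scal /= /mult /= Cmult_comm.
Qed.

Lemma psum_unique (a : nat -> C) (z l : C) : is_Cpseries a z l -> psum a z = l.
Proof.
move=> /is_Cpseries_mult H; rewrite /psum [RHS]surjective_pairing.
by congr pair; apply: is_series_unique; [exact: is_Cseries_fst | exact: is_Cseries_snd].
Qed.

(** Says that the radius of convergence is at least 1, in a form that survives shifting and
    multiplication by [k]. *)
Definition coef_bounded (a : nat -> C) : Prop :=
  forall r, 0 < r < 1 -> exists M, forall k, Cmod (a k) * r ^ k <= M.

Lemma eventually_bounded (u : nat -> R) N B :
  (forall n, (N <= n)%nat -> u n <= B) -> exists M, forall n, u n <= M.
Proof.
elim: N B => [|N IH] B H; first by exists B => n; apply: H; lia.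
apply: (IH (Rmax B (u N))) => n Hn.
case: (Nat.eq_dec n N) => [->|Hne]; first exact: Rmax_r.
apply: Rle_trans (Rmax_l _ _); apply: H; lia.
Qed.

Lemma coef_bounded_of_pseries (a : nat -> C) :
  (forall z, in_disk z -> exists l : C, is_Cpseries a z l) -> coef_bounded a.
Proof.
move=> H r Hr.
have Hd : in_disk (RtoC r) by rewrite /in_disk Cmod_R Rabs_pos_eq; lra.
have [l /is_Cpseries_mult Hl] := H _ Hd.
have [N HN] := proj1 (is_Cseries_Cmod _ _) Hl 1 ltac:(lra).
(* Term [n + 1] is the difference of two consecutive partial sums, each within 1 of the limit: hence
   the bound 2, valid from index [S N] on. *)
apply: (eventually_bounded _ (S N) 2) => -[|n] Hn; first by lia.
have H1 := HN n ltac:(lia); have H2 := HN (S n) ltac:(lia).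
rewrite sum_Sn in H2; set s := sum_n _ _ in H1 H2.
have -> : Cmod (a (S n)) * r ^ S n = Cmod (a (S n) * RtoC r ^ S n)%C.
{ rewrite Cmod_mult Cmod_pow Cmod_R Rabs_pos_eq //; lra. }
set t := (a (S n) * _)%C in H2 *.
have -> : t = (plus s t - l + - (s - l))%C by rewrite /plus /=; cring.
apply: Rle_trans (Cmod_triangle _ _) _; rewrite Cmod_opp; lra.
Qed.

(** A bound at the radius [(1 + r) / 2], strictly between [r] and 1, gives geometric decay at [r]
    with ratio [q = r / ((1 + r) / 2)]. *)
Lemma coef_bounded_summable a r : coef_bounded a -> 0 <= r < 1 ->
  ex_series (fun k => Cmod (a k) * r ^ k).
Proof.
move=> H Hr; have [M HM] := H ((1 + r) / 2) ltac:(lra).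
set q := r / ((1 + r) / 2).
have Hq : 0 <= q < 1.
{ rewrite /q; split; first by apply: Rdiv_le_0_compat; lra.
  apply/Rlt_div_l; lra. }
apply: (ex_series_le (K := R_AbsRing) (V := R_CompleteNormedModule) _ (fun k => M * q ^ k)).
- move=> k; rewrite /norm /= /abs /= Rabs_pos_eq;
    last by apply: Rmult_le_pos; [exact: Cmod_ge_0 | apply: pow_le; lra].
  have -> : r ^ k = ((1 + r) / 2) ^ k * q ^ k by rewrite -Rpow_mult_distr; congr (_ ^ _); rewrite /q; field; lra.
  rewrite -Rmult_assoc; apply: Rmult_le_compat_r (HM k); apply: pow_le; lra.
- apply: (ex_series_scal (V := R_NormedModule)); apply: ex_series_geom; rewrite Rabs_pos_eq; lra.
Qed.

Lemma psum_correct a z : coef_bounded a -> in_disk z -> is_Cpseries a z (psum a z).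
Proof.
move=> Ha Hz.
have [l Hl] : exists l : C, is_Cseries (fun k => (a k * z ^ k)%C) l.
{ apply: (ex_Cseries_le _ (fun k => Cmod (a k) * Cmod z ^ k)).
  - move=> k; rewrite Cmod_mult Cmod_pow; lra.
  - apply: coef_bounded_summable => //; split => //; exact: Cmod_ge_0. }
have Hp := proj2 (is_Cpseries_mult a z l) Hl.
by rewrite (psum_unique _ _ _ Hp).
Qed.

Lemma coef_bounded_incr a m : coef_bounded a -> coef_bounded (fun k => a (m + k)%nat).
Proof.
move=> H r Hr; have [M HM] := H r Hr; exists (M / r ^ m) => k.
have Hp := pow_lt r m ltac:(lra).
apply: (proj1 (Rle_div_r _ M _ Hp)).
rewrite Rmult_assoc -pow_add (Nat.add_comm k m); exact: HM.
Qed.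

(** The factor [k] is absorbed by enlarging the radius to [(1 + r) / 2 = (1 + x) r]: by Bernoulli,
    [k x <= (1 + x)^k]. *)
Lemma coef_bounded_INR a : coef_bounded a -> coef_bounded (fun k => RtoC (INR k) * a k)%C.
Proof.
move=> H r Hr; have [M HM] := H ((1 + r) / 2) ltac:(lra).
have HM0 : 0 <= M by apply: Rle_trans (HM 0%nat); rewrite /= Rmult_1_r; exact: Cmod_ge_0.
pose x := ((1 + r) / 2) / r - 1.
have Hx : 0 < x.
{ rewrite /x; have : 1 < ((1 + r) / 2) / r by apply/Rlt_div_r; lra. lra. }
exists (M / x) => k; apply: (proj1 (Rle_div_r _ M _ Hx)).
rewrite Cmod_mult Cmod_R Rabs_pos_eq; last exact: pos_INR.
have HB := poly k x Hx.
have E : (1 + x) ^ k * r ^ k = ((1 + r) / 2) ^ k.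
{ rewrite -Rpow_mult_distr; congr (_ ^ _); rewrite /x; field; lra. }
have Hr0 := pow_lt r k ltac:(lra).
apply: Rle_trans (HM k); rewrite -E.
have := Rmult_le_pos _ _ (Cmod_ge_0 (a k)) (Rlt_le _ _ Hr0).
set t := Cmod (a k) * r ^ k => Ht.
have -> : Cmod (a k) * ((1 + x) ^ k * r ^ k) = (1 + x) ^ k * t by rewrite /t; ring.
have -> : INR k * Cmod (a k) * r ^ k * x = INR k * x * t by rewrite /t; ring.
apply: Rmult_le_compat_r => //; lra.
Qed.

Definition deriv_coef (a : nat -> C) (k : nat) : C := (RtoC (INR (S k)) * a (S k))%C.

Lemma coef_bounded_deriv a : coef_bounded a -> coef_bounded (deriv_coef a).
Proof. move=> H; exact: (coef_bounded_incr _ 1 (coef_bounded_INR a H)). Qed.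

(** With [T_k] the second-order Taylor remainder of the power [k + 1], the recursion is
    [T_(k+1) = x T_k + (k + 1) (x - z)^2 z^k]. The factor [r] on the left replaces the exponent
    [k - 1] on the right; [k^2] dominates the sharp constant [k (k + 1) / 2]. *)
Lemma pow_taylor2 (x z : C) r k : 0 <= r -> Cmod x <= r -> Cmod z <= r ->
  Cmod (x ^ S k - z ^ S k - RtoC (INR (S k)) * (x - z) * z ^ k) * r
    <= INR k ^ 2 * r ^ k * Cmod (x - z) ^ 2.
Proof.
move=> Hr Hx Hz; elim: k => [|k IH].
- have -> : (x ^ 1 - z ^ 1 - RtoC (INR 1) * (x - z) * z ^ 0 = 0)%C by simpl; cring.
  rewrite Cmod_0 /=; lra.
- have -> : (x ^ S (S k) - z ^ S (S k) - RtoC (INR (S (S k))) * (x - z) * z ^ S k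
    = x * (x ^ S k - z ^ S k - RtoC (INR (S k)) * (x - z) * z ^ k)
      + RtoC (INR (S k)) * ((x - z) * (x - z)) * z ^ k)%C.
  { rewrite (S_INR (S k)) RtoC_plus /=; cring. }
  set T := (x ^ S k - _ - _)%C in IH *.
  apply: (Rle_trans _ ((r * Cmod T + INR (S k) * (Cmod (x - z) ^ 2 * r ^ k)) * r)).
  { apply: Rmult_le_compat_r => //; apply: Rle_trans (Cmod_triangle _ _) _.
    rewrite !Cmod_mult Cmod_R Cmod_pow Rabs_pos_eq; last exact: pos_INR.
    apply: Rplus_le_compat; first by apply: Rmult_le_compat_r => //; exact: Cmod_ge_0.
    rewrite Rmult_assoc; apply: Rmult_le_compat_l; first exact: pos_INR.
    rewrite (_ : Cmod (x - z) ^ 2 = Cmod (x - z) * Cmod (x - z)); last ring.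
    apply: Rmult_le_compat_l; first by apply: Rmult_le_pos; exact: Cmod_ge_0.
    apply: pow_incr; split => //; exact: Cmod_ge_0. }
  have Hk := pos_INR k; rewrite S_INR.
  have Hp := pow_le r k Hr.
  have Hm : 0 <= r ^ k * Cmod (x - z) ^ 2 * r by
    apply: Rmult_le_pos => //; apply: Rmult_le_pos => //; exact: pow2_ge_0.
  have := Rmult_le_compat_l r _ _ Hr IH; simpl (r ^ S k); nra.
Qed.

Lemma is_Cpseries_incr_1 (a : nat -> C) (z l : C) :
  is_Cpseries a z l -> is_Cseries (fun k => (a (S k) * z ^ S k)%C) (l - a 0%nat)%C.
Proof.
move=> /is_Cpseries_mult H; apply: (is_series_incr_1 (K := C_AbsRing) (V := C_NormedModule) (fun k => a k * z ^ k)%C).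
rewrite (_ : plus _ _ = l) //; rewrite /plus /=; cring.
Qed.

(** Summing [pow_taylor2] over the terms bounds the remainder by [(K / r) |x - z|^2], where [K] is
    the sum of [k^2 |a_(k+1)| r^k] and [r] lies midway between [|z|] and 1. *)
Lemma cderiv_psum a z : coef_bounded a -> in_disk z ->
  cderiv (psum a) z (psum (deriv_coef a) z).
Proof.
move=> Ha Hz; rewrite /in_disk in Hz; have Hz0 := Cmod_ge_0 z.
set r := (1 + Cmod z) / 2.
have Hb : coef_bounded (fun k => RtoC (INR k) * (RtoC (INR k) * a (1 + k)%nat))%C.
{ apply: coef_bounded_INR; apply: coef_bounded_INR; exact: (coef_bounded_incr a 1). }
have [K HK] := coef_bounded_summable _ r Hb ltac:(rewrite /r; lra).
have HK0 : 0 <= K.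
{ have Hr : in_disk (RtoC r) by rewrite /in_disk Cmod_R Rabs_pos_eq /r; lra.
  apply: Rle_trans (Cmod_ge_0 _) _.
  apply: is_Cseries_Cmod_le (proj1 (is_Cpseries_mult _ _ _) (psum_correct _ _ Hb Hr)) HK => k.
  rewrite Cmod_mult Cmod_pow (Cmod_R r) Rabs_pos_eq /r; lra. }
have HKr : 0 <= K / r by apply: Rdiv_le_0_compat; rewrite /r; lra.
apply: cderiv_of_little_o => e He.
(* The first bound keeps [|x| <= r], the second makes [(K / r) |x - z| <= e]; the [+ 1] keeps the
   denominator positive when [K = 0]. *)
exists (Rmin ((1 - Cmod z) / 2) (e / (K / r + 1))); split.
{ apply: Rmin_pos; [lra | apply: Rdiv_lt_0_compat; lra]. }
move=> x Hx.
have L1 := Rmin_l ((1 - Cmod z) / 2) (e / (K / r + 1)).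
have L2 := Rmin_r ((1 - Cmod z) / 2) (e / (K / r + 1)).
have Hxr : Cmod x <= r.
{ have : Cmod x <= Cmod (x - z) + Cmod z.
  { rewrite {1}(_ : x = x - z + z)%C; [exact: Cmod_triangle | cring]. }
  rewrite /r; lra. }
have Hzr : Cmod z <= r by rewrite /r; lra.
have Hr1 : 0 < r < 1 by rewrite /r; lra.
have Sx := is_Cpseries_incr_1 _ _ _ (psum_correct a x Ha ltac:(rewrite /in_disk; lra)).
have Sz := is_Cpseries_incr_1 _ _ _ (psum_correct a z Ha Hz).
have Sd := proj1 (is_Cpseries_mult _ _ _) (psum_correct _ z (coef_bounded_deriv a Ha) Hz).
have ST : is_Cseries (fun k => a (S k) * (x ^ S k - z ^ S k - RtoC (INR (S k)) * (x - z) * z ^ k))%C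
  (psum a x - psum a z - psum (deriv_coef a) z * (x - z))%C.
{ have H1 := is_series_plus _ _ _ _ Sx (is_series_opp _ _ Sz).
  have H2 := is_series_plus _ _ _ _ H1 (is_series_opp _ _ (is_series_scal (V := C_NormedModule) (x - z)%C _ _ Sd)).
  match type of H2 with is_series _ ?l => have E : l = (psum a x - psum a z - psum (deriv_coef a) z * (x - z))%C end.
  { rewrite /plus /opp /scal /= /mult /=; cring. }
  rewrite -E; apply: is_series_ext H2 => k.
  rewrite /plus /opp /scal /= /mult /deriv_coef /=; cring. }
apply: (Rle_trans _ (K / r * Cmod (x - z) ^ 2)).
{ apply: (is_Cseries_Cmod_le _ (fun k => (Cmod (x - z) ^ 2 / r) * (Cmod (RtoC (INR k) * (RtoC (INR k) * a (1 + k)%nat)) * r ^ k)) _ _ _ ST).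
  - move=> k; rewrite !Cmod_mult !Cmod_R Rabs_pos_eq; last exact: pos_INR.
    have := pow_taylor2 x z r k ltac:(lra) Hxr Hzr; set T := Cmod (_ - _ - _)%C => HT.
    have -> : Cmod (x - z) ^ 2 / r * (INR k * (INR k * Cmod (a (1 + k)%nat)) * r ^ k) =
       Cmod (a (S k)) * ((INR k ^ 2 * r ^ k * Cmod (x - z) ^ 2) / r) by simpl (1 + k)%nat; field; lra.
    apply: Rmult_le_compat_l; first exact: Cmod_ge_0.
    apply: (proj1 (Rle_div_r _ _ r _)); lra.
  - rewrite (_ : K / r * Cmod (x - z) ^ 2 = (Cmod (x - z) ^ 2 / r) * K); last by field; lra.
    exact: (is_series_scal (V := R_NormedModule)). }
have Hm := Cmod_ge_0 (x - z).
have : (K / r + 1) * Cmod (x - z) <= e.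
{ have : Cmod (x - z) <= e / (K / r + 1) by lra.
  move=> /Rle_div_r; rewrite Rmult_comm; apply; lra. }
nra.
Qed.

(** * Circle integrals *)

(** Continuity of the derivative is included because differentiation under the integral sign uses
    it. [U] may be any set: [cderiv] at a point already concerns a full neighbourhood. *)
Definition holo (U : C -> Prop) (F : C -> C) : Prop :=
  exists F' : C -> C, forall z, U z -> cderiv F z (F' z) /\ continuous F' z.

Lemma holo_const U c : holo U (fun _ => c).
Proof. by exists (fun _ => 0%C) => z _; split; [exact: cderiv_const | exact: continuous_const]. Qed.

Lemma holo_id U : holo U (fun z => z).
Proof. by exists (fun _ => 1%C) => z _; split; [exact: cderiv_id | exact: continuous_const]. Qed.

Lemma holo_plus U F G : holo U F -> holo U G -> holo U (fun z => F z + G z)%C.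
Proof.
move=> [F' HF] [G' HG]; exists (fun z => F' z + G' z)%C => z Uz.
have [F1 F2] := HF z Uz; have [G1 G2] := HG z Uz.
split; [exact: cderiv_plus | exact: continuous_Cplus].
Qed.

Lemma holo_mult U F G : holo U F -> holo U G -> holo U (fun z => F z * G z)%C.
Proof.
move=> [F' HF] [G' HG]; exists (fun z => F' z * G z + F z * G' z)%C => z Uz.
have [F1 F2] := HF z Uz; have [G1 G2] := HG z Uz.
split; first exact: cderiv_mult.
apply: continuous_Cplus; apply: continuous_Cmult => //; apply: cderiv_continuous; eassumption.
Qed.

Lemma holo_inv U F : holo U F -> (forall z, U z -> F z <> 0%C) -> holo U (fun z => / F z)%C.
Proof.
move=> [F' HF] H0; exists (fun z => - F' z / (F z * F z))%C => z Uz.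
have [F1 F2] := HF z Uz; have F0 := H0 z Uz; have F3 := cderiv_continuous _ _ _ F1.
split; first exact: cderiv_inv.
apply: continuous_Cmult; first exact: continuous_Copp.
by apply: continuous_Cinv; [exact: continuous_Cmult | exact: Cmult_neq_0].
Qed.

Lemma holo_pow U F n : holo U F -> holo U (fun z => F z ^ n)%C.
Proof.
move=> HF; elim: n => [|n IH] /=; first exact: holo_const.
exact: holo_mult.
Qed.

Lemma holo_comp (U V : C -> Prop) G F :
  holo V G -> holo U F -> (forall z, U z -> V (F z)) -> holo U (fun z => G (F z)).
Proof.
move=> [G' HG] [F' HF] HV; exists (fun z => G' (F z) * F' z)%C => z Uz.
have [F1 F2] := HF z Uz; have [G1 G2] := HG _ (HV z Uz).
split; first exact: cderiv_comp.
apply: continuous_Cmult => //; apply: (continuous_comp F G') => //; exact: cderiv_continuous F1.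
Qed.

Lemma holo_cexp U : holo U cexp.
Proof.
exists cexp => z _; have H := cderiv_cexp z; split => //; exact: cderiv_continuous H.
Qed.

Lemma holo_psum a : coef_bounded a -> holo in_disk (psum a).
Proof.
move=> Ha; exists (psum (deriv_coef a)) => z Hz; split; first exact: cderiv_psum.
apply: cderiv_continuous (cderiv_psum _ z (coef_bounded_deriv a Ha) Hz).
Qed.

Lemma holo_sub (U V : C -> Prop) F : (forall z, U z -> V z) -> holo V F -> holo U F.
Proof. by move=> H [F' HF]; exists F' => z /H /HF. Qed.

Notation continuousRC := (@continuous R_UniformSpace C_UniformSpace).

Lemma continuous_R_everywhere_ex_RInt (f : R -> R) a b :
  (forall t : R, continuous f t) -> ex_RInt f a b.
Proof. by move=> H; apply: (ex_RInt_continuous (V := R_CompleteNormedModule)) => t _. Qed.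

Definition CInt (u : R -> C) : C :=
  (RInt (fun t => fst (u t)) 0 (2 * PI), RInt (fun t => snd (u t)) 0 (2 * PI)).

Notation Rcont u := (forall t : R, continuousRC u t).

Lemma CInt_ext u v : (forall t, u t = v t) -> CInt u = CInt v.
Proof. by move=> H; congr pair; apply: RInt_ext => t _; rewrite H. Qed.

Lemma ex_RInt_fst (u : R -> C) : Rcont u -> ex_RInt (fun t => fst (u t)) 0 (2 * PI).
Proof. move=> H; apply: continuous_R_everywhere_ex_RInt => t; exact: continuous_Re. Qed.

Lemma ex_RInt_snd (u : R -> C) : Rcont u -> ex_RInt (fun t => snd (u t)) 0 (2 * PI).
Proof. move=> H; apply: continuous_R_everywhere_ex_RInt => t; exact: continuous_Im. Qed.

Lemma CInt_plus u v : Rcont u -> Rcont v ->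
  CInt (fun t => u t + v t)%C = (CInt u + CInt v)%C.
Proof.
move=> Hu Hv; congr pair.
- exact: (RInt_plus (V := R_CompleteNormedModule) _ _ _ _ (ex_RInt_fst u Hu) (ex_RInt_fst v Hv)).
- exact: (RInt_plus (V := R_CompleteNormedModule) _ _ _ _ (ex_RInt_snd u Hu) (ex_RInt_snd v Hv)).
Qed.

Lemma CInt_scal c u : Rcont u -> CInt (fun t => c * u t)%C = (c * CInt u)%C.
Proof.
move=> Hu; have H1 := ex_RInt_fst u Hu; have H2 := ex_RInt_snd u Hu.
have S1 l := RInt_scal (V := R_CompleteNormedModule) _ _ _ l H1.
have S2 l := RInt_scal (V := R_CompleteNormedModule) _ _ _ l H2.
have E1 l := ex_RInt_scal (V := R_CompleteNormedModule) _ _ _ l H1.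
have E2 l := ex_RInt_scal (V := R_CompleteNormedModule) _ _ _ l H2.
congr pair.
- have := RInt_minus (V := R_CompleteNormedModule) _ _ _ _ (E1 (fst c)) (E2 (snd c)).
  by rewrite S1 S2.
- have := RInt_plus (V := R_CompleteNormedModule) _ _ _ _ (E2 (fst c)) (E1 (snd c)).
  by rewrite S1 S2.
Qed.

(** The constant is [4 PI] because real and imaginary parts are estimated separately. This is
    harmless where it is used: once for a remainder tending to 0, once in an argument where
    constants disappear. *)
Lemma CInt_bound u M : Rcont u -> (forall t, 0 <= t <= 2 * PI -> Cmod (u t) <= M) -> Cmod (CInt u) <= 4 * PI * M.
Proof.
move=> Hu HM; apply: Rle_trans (Cmod_pair_le _ _) _.
have HP := PI_RGT_0.
have H1 := abs_RInt_le_const (fun t => fst (u t)) 0 (2 * PI) M ltac:(lra) (ex_RInt_fst u Hu).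
have H2 := abs_RInt_le_const (fun t => snd (u t)) 0 (2 * PI) M ltac:(lra) (ex_RInt_snd u Hu).
have B t Ht := Rle_trans _ _ _ (Rmax_Cmod (u t)) (HM t Ht).
have {}H1 := H1 (fun t Ht => Rle_trans _ _ _ (Rmax_l _ _) (B t Ht)).
have {}H2 := H2 (fun t Ht => Rle_trans _ _ _ (Rmax_r _ _) (B t Ht)).
lra.
Qed.

(** * Differentiable curves in the plane and the circle *)

Definition Rcderiv (u : R -> C) (t : R) (l : C) : Prop :=
  exists psi : R -> C, continuousRC psi t /\ psi t = l /\
    locally t (fun s => u s = u t + psi s * RtoC (s - t))%C.

Lemma Rcderiv_continuous u t l : Rcderiv u t l -> continuousRC u t.
Proof.
move=> [psi [Hc [_ Hl]]].
apply: (continuous_ext_loc _ (fun s => u t + psi s * RtoC (s - t))%C).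
{ by apply: filter_imp Hl => s ->. }
apply: continuous_Cplus; first exact: continuous_const.
apply: continuous_Cmult => //; apply: continuous_RtoC.
apply: (continuous_minus (V := R_NormedModule)); [exact: continuous_id | exact: continuous_const].
Qed.

Lemma Rcderiv_comp F u t l m : cderiv F (u t) m -> Rcderiv u t l ->
  Rcderiv (fun s => F (u s)) t (m * l).
Proof.
move=> [Phi [Pc [Pz Pl]]] Hu; have Hc := Rcderiv_continuous _ _ _ Hu.
move: Hu => [psi [Qc [Qz Ql]]].
exists (fun s => Phi (u s) * psi s)%C; split.
{ apply: continuous_Cmult => //; exact: (continuous_comp u Phi). }
split; first by rewrite Pz Qz.
have Pl' : locally t (fun s => F (u s) = F (u t) + Phi (u s) * (u s - u t))%C := Hc _ Pl.
apply: filter_imp (filter_and _ _ Pl' Ql) => s [E1 E2].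
rewrite E1 {2}E2; cring.
Qed.

(** Real parts are enough: an imaginary part is the real part after multiplication by [- Ci]. *)
Lemma Rcderiv_is_derive_fst u t l : Rcderiv u t l -> is_derive (fun s => fst (u s)) t (fst l).
Proof.
move=> [psi [Hc [<- Hl]]]; apply/is_derive_slope; exists (fun s => fst (psi s)).
split; first exact: continuous_Re.
split => //; apply: filter_imp Hl => s ->; simpl; ring.
Qed.

Lemma Rcderiv_affine a b t : Rcderiv (fun s => a + RtoC s * b)%C t b.
Proof.
exists (fun _ => b); split; first exact: continuous_const.
split => //; apply: filter_forall => s; rewrite RtoC_minus; cring.
Qed.

Definition circ (r t : R) : C := (RtoC r * cexp (RtoC t * Ci))%C.

Lemma Cmod_circ r t : Cmod (circ r t) = Rabs r.
Proof. rewrite Cmod_mult Cmod_R Cmod_cexp /= (_ : t * 0 - 0 * 1 = 0); [rewrite exp_0|]; ring. Qed.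

Lemma Rcderiv_circ r t : Rcderiv (circ r) t (Ci * circ r t).
Proof.
have H : Rcderiv (fun s => (fun z => RtoC r * cexp z) (0 + RtoC s * Ci))%C t
   (RtoC r * cexp (0 + RtoC t * Ci) * Ci)%C.
{ apply: (Rcderiv_comp (fun z => RtoC r * cexp z)%C (fun s => 0 + RtoC s * Ci)%C);
    last exact: Rcderiv_affine.
  apply: cderiv_scal; exact: cderiv_cexp. }
have E s : (0 + RtoC s * Ci = RtoC s * Ci)%C by ring.
rewrite /circ; move: H; rewrite /= E => -[psi [H1 [H2 H3]]].
exists psi; split => //; split; first by rewrite H2; cring.
apply: filter_imp H3 => s; by rewrite !E.
Qed.

Lemma continuous_circ r t : continuousRC (circ r) t.
Proof. exact: Rcderiv_continuous (Rcderiv_circ r t). Qed.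

Lemma circ_period r : circ r (2 * PI) = circ r 0.
Proof.
have E x : cexp (RtoC x * Ci) = (cos x, sin x).
{ rewrite /cexp /= (_ : x * 0 - 0 * 1 = 0); last ring.
  rewrite (_ : x * 1 + 0 * 0 = x); last ring.
  by rewrite exp_0 !Rmult_1_l. }
by rewrite /circ !E sin_2PI cos_2PI sin_0 cos_0.
Qed.

(* J has derivative the integral of F' (z + l (zeta - z)) zeta, an exact integrand on the circle. *)
Lemma CInt_homotopy_fst F F' z r l0 l1 :
  (forall l t, l0 < l < l1 -> cderiv F (z + RtoC l * (circ r t - z)) (F' (z + RtoC l * (circ r t - z))%C)
     /\ continuous F' (z + RtoC l * (circ r t - z))%C) ->
  (forall t, circ r t <> z) ->
  forall s t, l0 < s < l1 -> l0 < t < l1 -> s < t ->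
  let J l := RInt (fun t => fst (F (z + RtoC l * (circ r t - z)) * (circ r t / (circ r t - z)))%C) 0 (2 * PI) in
  J s = J t.
Proof.
move=> HF Hz s t Hs Ht Hst J.
have Hz' u : (circ r u - z <> 0)%C by move=> E; apply: (Hz u); rewrite (_ : circ r u = circ r u - z + z)%C; [rewrite E; ring | ring].
have Hline l u : Rcderiv (fun l => z + RtoC l * (circ r u - z))%C l (circ r u - z) by exact: Rcderiv_affine.
have Hder l u : l0 < l < l1 -> is_derive (fun l => fst (F (z + RtoC l * (circ r u - z)) * (circ r u / (circ r u - z)))%C) l
    (fst (F' (z + RtoC l * (circ r u - z)) * circ r u)%C).
{ move=> Hl; have [H1 _] := HF l u Hl.
  have H2 := Rcderiv_comp _ _ _ _ _ (cderiv_scal (circ r u / (circ r u - z))%C _ _ _ H1) (Hline l u).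
  have H3 := Rcderiv_is_derive_fst _ _ _ H2.
  have E : fst (circ r u / (circ r u - z) * F' (z + RtoC l * (circ r u - z)) * (circ r u - z))%C
     = fst (F' (z + RtoC l * (circ r u - z)) * circ r u)%C.
  { congr fst; cfield; exact: Hz'. }
  rewrite -E; apply: is_derive_ext H3 => x; congr fst; cring. }
have Hcircle l u : Rcderiv (fun u => z + RtoC l * (circ r u - z))%C u (RtoC l * (Ci * circ r u))%C.
{ have H1 : cderiv (fun w => z + RtoC l * (w + - z))%C (circ r u) (0 + RtoC l * (1 + 0))%C.
  { apply: cderiv_plus; first exact: cderiv_const.
    apply: cderiv_scal; apply: cderiv_plus; [exact: cderiv_id | exact: cderiv_const]. }
  have := Rcderiv_comp _ _ _ _ _ H1 (Rcderiv_circ r u).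
  by rewrite (_ : ((0 + RtoC l * (1 + 0)) * (Ci * circ r u) = RtoC l * (Ci * circ r u))%C); last ring. }
have Hcont l u : l0 < l < l1 -> continuousRC (fun u => F (z + RtoC l * (circ r u - z)))%C u.
{ move=> Hl; apply: (continuous_comp (fun u => z + RtoC l * (circ r u - z))%C F).
  - exact: Rcderiv_continuous (Hcircle l u).
  - exact: cderiv_continuous (proj1 (HF l u Hl)). }
have HK u : continuousRC (fun u => circ r u / (circ r u - z))%C u.
{ apply: continuous_Cmult; first exact: continuous_circ.
  apply: continuous_Cinv; last exact: Hz'.
  apply: continuous_Cminus; [exact: continuous_circ | exact: continuous_const]. }
have Hcont' l u : l0 < l < l1 -> continuousRC (fun u => F' (z + RtoC l * (circ r u - z)) * circ r u)%C u.
{ move=> Hl; apply: continuous_Cmult; last exact: continuous_circ.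
  apply: (continuous_comp (fun u => z + RtoC l * (circ r u - z))%C F').
  - exact: Rcderiv_continuous (Hcircle l u).
  - exact: (proj2 (HF l u Hl)). }
have Hzero l : l0 < l < l1 -> RInt (fun u => fst (F' (z + RtoC l * (circ r u - z)) * circ r u)%C) 0 (2 * PI) = 0.
{ move=> Hl.
  have [G [HG Gp]] : exists G, (forall u, Rcderiv G u (F' (z + RtoC l * (circ r u - z)) * circ r u)%C)
      /\ G (2 * PI) = G 0.
  (* For [l <> 0] a primitive in [u] is [F (z + l (zeta - z)) / (l i)]; at [l = 0] the factor [F' z]
     is constant and [- i F' z zeta] is a primitive. Both are periodic, so the integral vanishes. *)
  { case: (Req_dec l 0) => [El|Nl].
    - exists (fun u => F' z * - Ci * circ r u)%C; rewrite circ_period; split => // u.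
      have := Rcderiv_comp _ _ _ _ _ (cderiv_scal (F' z * - Ci)%C _ _ _ (cderiv_id (circ r u))) (Rcderiv_circ r u).
      rewrite El (_ : z + 0 * (circ r u - z) = z)%C; last ring.
      rewrite (_ : F' z * - Ci * 1 * (Ci * circ r u) = F' z * circ r u)%C //.
      have E : (Ci * Ci = - (1))%C by apply: injective_projections => /=; ring.
      rewrite (_ : F' z * - Ci * 1 * (Ci * circ r u) = - (Ci * Ci) * (F' z * circ r u))%C; last ring.
      rewrite E; ring.
    - have Nl' : RtoC l <> 0%C by move=> E; apply: Nl; exact: (f_equal fst E).
      exists (fun u => / (RtoC l * Ci) * F (z + RtoC l * (circ r u - z)))%C; rewrite circ_period; split => // u.
      have := Rcderiv_comp _ _ _ _ _ (cderiv_scal (/ (RtoC l * Ci))%C _ _ _ (proj1 (HF l u Hl))) (Hcircle l u).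
      rewrite (_ : / (RtoC l * Ci) * F' (z + RtoC l * (circ r u - z)) * (RtoC l * (Ci * circ r u))
          = F' (z + RtoC l * (circ r u - z)) * circ r u)%C //.
      field; split => // E; have := f_equal snd E => /=; lra. }
  have HI : is_RInt (V := R_NormedModule) (fun u => fst (F' (z + RtoC l * (circ r u - z)) * circ r u)%C) 0 (2 * PI)
     (minus (fst (G (2 * PI))) (fst (G 0))).
  { apply: (is_RInt_derive (V := R_CompleteNormedModule) (fun u => fst (G u))) => u _.
    - exact: Rcderiv_is_derive_fst.
    - apply: continuous_Re; exact: Hcont'. }
  rewrite (is_RInt_unique _ _ _ _ HI) Gp /minus /plus /opp /=; ring. }
have HJ l : l0 < l < l1 -> is_derive J l 0.
{ move=> Hl.
  have Hloc : locally l (fun x => l0 < x < l1).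
  { exact: (open_and _ _ (open_gt l0) (open_lt l1) l Hl). }
  have HD x u : l0 < x < l1 ->
    Derive (fun l => fst (F (z + RtoC l * (circ r u - z)) * (circ r u / (circ r u - z)))%C) x
      = fst (F' (z + RtoC x * (circ r u - z)) * circ r u)%C.
  { move=> Hx; exact: is_derive_unique (Hder x u Hx). }
  rewrite -(Hzero l Hl) -(RInt_ext _ _ _ _ (fun u _ => HD l u Hl)).
  (* The joint continuity of the [l]-derivative, required here, comes from the continuity of
     [F']. *)
  apply: (is_derive_RInt_param (fun l u => fst (F (z + RtoC l * (circ r u - z)) * (circ r u / (circ r u - z)))%C)).
  - apply: filter_imp Hloc => x Hx u _; eexists; exact: Hder.
  - move=> u _.
    apply: (continuity_2d_pt_ext_loc (fun x v => fst (F' (z + RtoC x * (circ r v - z)) * circ r v)%C)).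
    { move: Hloc => [d Hd]; exists d => x v Hx _; rewrite HD //; exact: Hd. }
    apply/continuity_2d_pt_filterlim.
    have C2 : continuous (U := prod_UniformSpace R_UniformSpace R_UniformSpace) (fun p : R * R => circ r (snd p)) (l, u).
    { apply: (continuous_comp (fun p : R * R => snd p) (circ r)); [exact: continuous_snd | exact: continuous_circ]. }
    apply: (continuous_Re (U := prod_UniformSpace R_UniformSpace R_UniformSpace) (fun p : R * R => F' (z + RtoC (fst p) * (circ r (snd p) - z)) * circ r (snd p))%C (l, u)).
    apply: continuous_Cmult => //.
    apply: (continuous_comp (fun p : R * R => z + RtoC (fst p) * (circ r (snd p) - z))%C F');
      last exact: (proj2 (HF l u Hl)).
    apply: continuous_Cplus; first exact: continuous_const.
    apply: continuous_Cmult; first by apply: continuous_RtoC; exact: continuous_fst.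
    apply: continuous_Cminus => //; exact: continuous_const.
  - apply: filter_imp Hloc => x Hx; apply: ex_RInt_fst => u.
    apply: continuous_Cmult => //; exact: Hcont. }
(* A zero derivative is required at the endpoints [s] and [t] too, hence the hypotheses on an open
   interval around them. *)
apply: (eq_is_derive (V := R_NormedModule)) => // l Hl; apply: HJ; lra.
Qed.

(** * Cauchy's formula and Taylor's theorem *)

(** Since [d zeta = i zeta dt] on the circle, this is the Cauchy kernel [d zeta / (i (zeta - z))]
    written against [dt]. *)
Definition ckernel (r : R) (z : C) (t : R) : C := (circ r t / (circ r t - z))%C.

Lemma circ_neq r z t : Cmod z < Rabs r -> circ r t <> z.
Proof. move=> H E; rewrite -E Cmod_circ in H; lra. Qed.

Lemma circ_minus_neq0 r z t : Cmod z < Rabs r -> (circ r t - z <> 0)%C.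
Proof.
move=> H E; apply: (circ_neq r z t H).
rewrite (_ : circ r t = circ r t - z + z)%C; [rewrite E; ring | ring].
Qed.

Lemma continuous_ckernel r z t : Cmod z < Rabs r -> continuousRC (ckernel r z) t.
Proof.
move=> H; apply: continuous_Cmult; first exact: continuous_circ.
apply: continuous_Cinv; last exact: circ_minus_neq0.
apply: continuous_Cminus; [exact: continuous_circ | exact: continuous_const].
Qed.

(** The imaginary part is the real-part statement for [- i F]. The set [U] is free because the disk
    serves for Cauchy's formula and the punctured disk for the change of radius. *)
Lemma CInt_homotopy U F z r l0 l1 s t :
  holo U F -> Cmod z < Rabs r ->
  (forall l t, l0 < l < l1 -> U (z + RtoC l * (circ r t - z))%C) ->
  l0 < s < l1 -> l0 < t < l1 -> s <= t ->
  CInt (fun u => F (z + RtoC s * (circ r u - z)) * ckernel r z u)%C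
  = CInt (fun u => F (z + RtoC t * (circ r u - z)) * ckernel r z u)%C.
Proof.
move=> HF Hr HU Hs Ht [Hst|->] //.
have Hz u := circ_neq r z u Hr.
congr pair.
- move: HF => [F' HF].
  exact: (CInt_homotopy_fst F F' z r l0 l1 (fun l u Hl => HF _ (HU l u Hl)) Hz s t Hs Ht Hst).
- have [F' HF'] := holo_mult _ _ _ (holo_const U (- Ci)) HF.
  have := CInt_homotopy_fst _ F' z r l0 l1 (fun l u Hl => HF' _ (HU l u Hl)) Hz s t Hs Ht Hst.
  cbv zeta => H.
  have E (w k : C) : snd (w * k)%C = fst (- Ci * w * k)%C by simpl; ring.
  apply: eq_trans (eq_trans _ H) _; apply: RInt_ext => u _; [exact: E | symmetry; exact: E].
Qed.

Lemma Rcont_circ_comp F r : holo in_disk F -> Rabs r < 1 ->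
  forall t, continuousRC (fun u => F (circ r u)) t.
Proof.
move=> [F' HF] Hr t; apply: (continuous_comp (circ r) F); first exact: continuous_circ.
apply: cderiv_continuous (proj1 (HF _ _)); by rewrite /in_disk Cmod_circ.
Qed.

(** [l = 1] gives the integral over the circle and [l = 0] freezes [F] at [z]. The kernel integral
    is evaluated separately, in [CInt_ckernel]. *)
Lemma CInt_cauchy F z r : holo in_disk F -> Cmod z < r < 1 ->
  CInt (fun u => F (circ r u) * ckernel r z u)%C = (F z * CInt (ckernel r z))%C.
Proof.
move=> HF Hr; have Hz0 := Cmod_ge_0 z.
have Ar : Rabs r = r by rewrite Rabs_pos_eq; lra.
rewrite -CInt_scal; last by move=> t; apply: continuous_ckernel; lra.
(* For [- e < l < 1 + e] the moved points have modulus at most [r (1 + 2 e) = r (2 - r) < 1]. *)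
set e := (1 - r) / 2.
have := CInt_homotopy in_disk F z r (- e) (1 + e) 0 1 HF ltac:(lra) _ ltac:(rewrite /e; lra) ltac:(rewrite /e; lra) ltac:(lra).
move=> H; symmetry.
rewrite (CInt_ext (fun t => F z * ckernel r z t)%C (fun u => F (z + 0 * (circ r u - z)) * ckernel r z u)%C);
  last by move=> t; congr (F _ * _)%C; ring.
rewrite H.
- by apply: CInt_ext => t; congr (F _ * _)%C; ring.
- move=> l t Hl; rewrite /in_disk.
  have -> : (z + RtoC l * (circ r t - z) = RtoC (1 - l) * z + RtoC l * circ r t)%C by rewrite RtoC_minus; ring.
  apply: Rle_lt_trans (Cmod_triangle _ _) _; rewrite (Cmod_mult _ z) (Cmod_mult _ (circ r t)) !Cmod_R Cmod_circ Ar.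
  have H1 : Rabs (1 - l) + Rabs l <= 1 + 2 * e.
  { rewrite /e in Hl *; rewrite /Rabs; case: Rcase_abs => ?; case: Rcase_abs => ?; lra. }
  have H2 := Rabs_pos (1 - l).
  rewrite /e in H1; nra.
Qed.

Lemma Rcont_bounded u : Rcont u -> exists M, forall t, 0 <= t <= 2 * PI -> Cmod (u t) <= M.
Proof.
move=> Hu; have HP := PI_RGT_0.
have HB (f : R -> R) : (forall t : R, continuous f t) -> exists M, forall t, 0 <= t <= 2 * PI -> Rabs (f t) <= M.
{ move=> Hf; have [m [Hm _]] := continuity_ab_maj (fun t => Rabs (f t)) 0 (2 * PI) ltac:(lra)
    (fun t _ => proj2 (continuity_pt_filterlim _ _) (continuous_comp f Rabs t (Hf t) (continuous_Rabs _))).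
  by exists (Rabs (f m)). }
have [M1 H1] := HB _ (fun t => continuous_Re u t (Hu t)).
have [M2 H2] := HB _ (fun t => continuous_Im u t (Hu t)).
exists (M1 + M2) => t Ht; rewrite (surjective_pairing (u t)).
apply: Rle_trans (Cmod_pair_le _ _) _; apply: Rplus_le_compat; auto.
Qed.

(** Iterating [zeta / (zeta - z) = 1 + (z / zeta) (zeta / (zeta - z))] under the integral gives an
    exact remainder after finitely many terms, so no infinite sum is exchanged with an integral; the
    remainder decays like [(|z| / r)^n]. *)
Lemma CInt_kernel_pseries u z r : Rcont u -> Cmod z < r ->
  is_Cpseries (fun k => CInt (fun t => u t * (/ circ r t) ^ k)%C) z
    (CInt (fun t => u t * ckernel r z t)%C).
Proof.
move=> Hu Hr; have Hz0 := Cmod_ge_0 z.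
have Ar : Rabs r = r by rewrite Rabs_pos_eq; lra.
have [M HM] := Rcont_bounded u Hu.
have N0 t : circ r t <> 0%C by apply: circ_neq; rewrite Cmod_0; lra.
have Nz t : (circ r t - z <> 0)%C by apply: circ_minus_neq0; lra.
have Cc k : Rcont (fun t => u t * (/ circ r t) ^ k)%C.
{ move=> t; apply: continuous_Cmult => //; apply: continuous_Cpow.
  by apply: continuous_Cinv; [exact: continuous_circ | exact: N0]. }
have CK k : Rcont (fun t => u t * (/ circ r t) ^ k * ckernel r z t)%C.
{ move=> t; apply: continuous_Cmult; [exact: Cc | apply: continuous_ckernel; lra]. }
have HI k : CInt (fun t => u t * (/ circ r t) ^ k * ckernel r z t)%C
  = (CInt (fun t => u t * (/ circ r t) ^ k) + z * CInt (fun t => u t * (/ circ r t) ^ S k * ckernel r z t))%C.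
{ rewrite -CInt_scal // -CInt_plus //;
    last by move=> t; apply: continuous_Cmult; [exact: continuous_const | exact: CK].
  apply: CInt_ext => t; rewrite /ckernel Cpow_S; field; split; [exact: Nz | exact: N0]. }
have HS n : (CInt (fun t => u t * ckernel r z t) - sum_n (G := C_AbelianMonoid) (fun k => CInt (fun t => u t * (/ circ r t) ^ k) * z ^ k) n
  = z ^ S n * CInt (fun t => u t * (/ circ r t) ^ S n * ckernel r z t))%C.
{ elim: n => [|n IH].
  - rewrite sum_O (CInt_ext _ (fun t => u t * (/ circ r t) ^ 0 * ckernel r z t)%C);
      last by move=> t /=; ring.
    rewrite HI /=; ring.
  - rewrite sum_Sn /plus /=; set s := sum_n _ _ in IH *.
    match goal with |- (?a - (s + ?b))%C = _ => have -> : (a - (s + b) = (a - s) - b)%C by ring end.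
    rewrite IH (HI (S n)) /=; ring. }
apply/is_Cpseries_mult/is_Cseries_Cmod => e He.
set q := Cmod z / r.
have Hq : 0 <= q < 1.
{ rewrite /q; split; first by apply: Rdiv_le_0_compat; lra.
  apply/Rlt_div_l; lra. }
(* Here [M] bounds [u], [r / (r - |z|)] bounds the kernel, and [4 * PI] comes from [CInt_bound]. *)
set B := 4 * PI * (M * (r / (r - Cmod z))).
have HB n : Cmod (z ^ n * CInt (fun t => u t * (/ circ r t) ^ n * ckernel r z t))%C <= q ^ n * B.
{ rewrite Cmod_mult Cmod_pow /q Rpow_mult_distr Rmult_assoc.
  apply: Rmult_le_compat_l; first exact: pow_le.
  have -> : (/ r) ^ n * B = 4 * PI * (M * (/ r) ^ n * (r / (r - Cmod z))) by rewrite /B; ring.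
  apply: CInt_bound => // t Ht.
  rewrite (Cmod_mult _ (ckernel r z t)) (Cmod_mult (u t)) Cmod_pow Cmod_inv // Cmod_circ Ar.
  have Hp : 0 <= (/ r) ^ n by apply: pow_le; apply: Rlt_le; apply: Rinv_0_lt_compat; lra.
  apply: Rmult_le_compat.
  - apply: Rmult_le_pos => //; exact: Cmod_ge_0.
  - exact: Cmod_ge_0.
  - apply: Rmult_le_compat_r => //; exact: HM.
  - rewrite Cmod_div // Cmod_circ Ar; apply: Rmult_le_compat_l; first lra.
    apply: Rinv_le_contravar; first lra.
    have := Cmod_triangle (circ r t - z) z.
    rewrite (_ : circ r t - z + z = circ r t)%C; last ring.
    rewrite Cmod_circ; lra. }
have HL : is_lim_seq (fun n => q ^ n * B) (0 * B).
{ apply: is_lim_seq_mult'; last exact: is_lim_seq_const.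
  apply: is_lim_seq_geom; rewrite Rabs_pos_eq; lra. }
rewrite Rmult_0_l in HL.
have [N HN] := proj1 (is_lim_seq_Reals _ _) HL e He.
exists N => n Hn.
rewrite -Cmod_opp; set s := sum_n _ _.
rewrite (_ : - (s - _) = CInt (fun t => u t * ckernel r z t) - s)%C; last cring.
rewrite /s HS; apply: Rle_lt_trans (HB (S n)) _.
have := HN (S n) ltac:(lia); rewrite /Rdist Rminus_0_r.
have := Rle_abs (q ^ S n * B); lra.
Qed.

Lemma CInt_derive G u : (forall t, Rcderiv G t (u t)) -> Rcont u ->
  CInt u = (G (2 * PI)%R - G 0)%C.
Proof.
move=> HG Hu; congr pair; apply: is_RInt_unique.
- apply: (is_RInt_derive (V := R_CompleteNormedModule) (fun t => fst (G t))) => t _.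
  + exact: Rcderiv_is_derive_fst.
  + exact: continuous_Re.
- apply: (is_RInt_derive (V := R_CompleteNormedModule) (fun t => snd (G t))) => t _.
  + have := Rcderiv_is_derive_fst _ _ _ (Rcderiv_comp _ _ _ _ _ (cderiv_scal (- Ci) _ _ _ (cderiv_id (G t))) (HG t)).
    rewrite (_ : fst (- Ci * 1 * u t)%C = snd (u t)); last by simpl; ring.
    by apply: is_derive_ext => s /=; ring.
  + exact: continuous_Im.
Qed.

(** The integrand has the periodic primitive [i / (k + 1)] times itself, the exponent being
    [- (k + 1)]. *)
Lemma CInt_circ_neg_pow r k : r <> 0 -> CInt (fun t => (/ circ r t) ^ S k)%C = 0%C.
Proof.
move=> Hr.
have N0 t : circ r t <> 0%C by apply: circ_neq; rewrite Cmod_0; exact: Rabs_pos_lt.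
have Nk : RtoC (INR (S k)) <> 0%C by move=> E; apply: (not_0_INR (S k)) => //; exact: (f_equal fst E).
have NC : Ci <> 0%C by move=> E; have := f_equal snd E => /=; lra.
rewrite (CInt_derive (fun t => Ci / RtoC (INR (S k)) * (/ circ r t) ^ S k)%C).
- rewrite circ_period; ring.
- move=> t.
  have H1 := cderiv_comp _ _ _ _ _ (cderiv_pow k (/ circ r t)%C) (cderiv_inv _ _ _ (cderiv_id (circ r t)) (N0 t)).
  have := Rcderiv_comp _ _ _ _ _ (cderiv_scal (Ci / RtoC (INR (S k)))%C _ _ _ H1) (Rcderiv_circ r t).
  rewrite (_ : _ * _ * _ = (/ circ r t) ^ S k)%C //.
  rewrite Cpow_S.
  rewrite (_ : _ * _ * _ = - (Ci * Ci) * (/ circ r t * (/ circ r t) ^ k))%C; last by field.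
  rewrite (_ : Ci * Ci = - (1))%C; last by apply: injective_projections => /=; ring.
  ring.
- move=> t; apply: continuous_Cpow.
  by apply: continuous_Cinv; [exact: continuous_circ | exact: N0].
Qed.

(** Expanding the kernel with [u = 1], only the coefficient of index 0 survives. *)
Lemma CInt_ckernel z r : Cmod z < r -> CInt (ckernel r z) = RtoC (2 * PI).
Proof.
move=> Hr; have Hz0 := Cmod_ge_0 z.
have Hu : Rcont (fun _ : R => RtoC 1) by move=> t; exact: continuous_const.
have H := proj1 (is_Cpseries_mult _ _ _) (CInt_kernel_pseries _ z r Hu Hr).
have E1 : CInt (fun _ => 1%C) = RtoC (2 * PI).
{ rewrite /CInt /=.
  rewrite !RInt_const /scal /= /mult /=; congr pair; ring. }
have H2 : is_Cseries (fun k => (CInt (fun t => 1 * (/ circ r t) ^ k) * z ^ k)%C) (RtoC (2 * PI)).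
{ apply/is_Cseries_Cmod => e He; exists 0%nat => n _.
  have -> : sum_n (G := C_AbelianMonoid) (fun k => (CInt (fun t => 1 * (/ circ r t) ^ k) * z ^ k)%C) n = RtoC (2 * PI).
  { elim: n => [|n IH].
    - rewrite sum_O /= -E1 (CInt_ext _ (fun _ => 1%C)); [ring | by move=> t; ring].
    - rewrite sum_Sn IH (CInt_ext _ (fun t => (/ circ r t) ^ S n)%C); last by move=> t; ring.
      rewrite CInt_circ_neg_pow; last lra.
      rewrite /plus /=; ring. }
  rewrite (_ : _ - _ = 0)%C; [by rewrite Cmod_0 | ring]. }
rewrite -(is_Cseries_unique _ _ _ H H2); apply: CInt_ext => t; ring.
Qed.

(** The coefficients must serve all [z], whereas Cauchy's formula needs a circle of radius above
    [|z|]. They are therefore taken on the circle of radius [1 / 2] and shown to be the same on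
    every circle of radius [r]. *)
Lemma holo_in_disk_analytic F : holo in_disk F -> analytic_disk F.
Proof.
move=> HF.
exists (fun k => / RtoC (2 * PI) * CInt (fun t => F (circ (1 / 2) t) * (/ circ (1 / 2) t) ^ k))%C => z Hz.
rewrite /in_disk in Hz; have Hz0 := Cmod_ge_0 z.
have HP := PI_RGT_0.
have NP : RtoC (2 * PI) <> 0%C by move=> E; have := f_equal fst E => /=; lra.
set r := (1 + Cmod z) / 2.
have Hr : Cmod z < r < 1 by rewrite /r; lra.
have Ar : Rabs r = r by rewrite Rabs_pos_eq; lra.
have Ah : Rabs (1 / 2) = 1 / 2 by rewrite Rabs_pos_eq; lra.
have H := CInt_kernel_pseries _ z r (Rcont_circ_comp F r HF ltac:(lra)) (proj1 Hr).
rewrite (CInt_cauchy F z r HF Hr) CInt_ckernel in H; last lra.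
have Hs (k : nat) : CInt (fun t => F (circ r t) * (/ circ r t) ^ k)%C
    = CInt (fun t => F (circ (1 / 2) t) * (/ circ (1 / 2) t) ^ k)%C.
{ pose U := fun w : C => in_disk w /\ w <> 0%C.
  have HG : holo U (fun w => F w * (/ w) ^ k)%C.
  { apply: holo_mult; first by apply: holo_sub HF => w [].
    apply: holo_pow; apply: holo_inv; [exact: holo_id | by move=> w []]. }
  have Hk t : ckernel (1 / 2) 0 t = 1%C.
  { rewrite /ckernel; field; apply: circ_neq; rewrite Cmod_0; lra. }
  have Hc l t : (0 + RtoC l * (circ (1 / 2) t - 0) = circ (l * (1 / 2)) t)%C.
  { rewrite /circ RtoC_mult; ring. }
  (* With centre 0, the factor [l] turns radius [1 / 2] into [l / 2]: the range [0 < l < 2] covers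
     exactly the punctured disk, and [1 <= 2 r] since [r >= 1 / 2]. *)
  have := CInt_homotopy U _ 0%C (1 / 2) 0 2 1 (2 * r) HG ltac:(rewrite Cmod_0; lra) _ ltac:(lra) ltac:(lra) ltac:(rewrite /r; lra).
  move=> X; symmetry.
  rewrite (CInt_ext _ (fun u => (F (0 + RtoC 1 * (circ (1 / 2) u - 0)) * (/ (0 + RtoC 1 * (circ (1 / 2) u - 0))) ^ k) * ckernel (1 / 2) 0 u)%C);
    last by move=> t; rewrite Hc Hk Rmult_1_l Cmult_1_r.
  rewrite X.
  - apply: CInt_ext => t; rewrite Hc Hk Cmult_1_r.
    by rewrite (_ : 2 * r * (1 / 2) = r); last field.
  - move=> l t Hl; rewrite Hc; split.
    + rewrite /in_disk Cmod_circ Rabs_pos_eq; lra.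
    + apply: circ_neq; rewrite Cmod_0 Rabs_pos_eq; lra. }
have := is_series_scal (K := C_AbsRing) (V := C_NormedModule) (/ RtoC (2 * PI))%C _ _ (proj1 (is_Cpseries_mult _ _ _) H).
move=> H2; apply/is_Cpseries_mult.
have <- : (/ RtoC (2 * PI) * (F z * RtoC (2 * PI)) = F z)%C by field.
apply: is_series_ext H2 => k; rewrite Hs /scal /= /mult /=; ring.
Qed.

(** If [A / S = 1 + x] with [x > 0], Bernoulli makes [(A / S)^m] exceed any constant [K]. *)
Lemma pow_bound_le A S K : 0 <= A -> 0 <= S -> (forall m, A ^ m <= K * S ^ m) -> A <= S.
Proof.
move=> HA HS H; apply: Rnot_lt_le => Hlt.
have HK : 1 <= K by have := H 0%nat; rewrite /=; lra.
case: (Req_dec S 0) => [E|N].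
{ have := H 1%nat; rewrite E /=; lra. }
set x := A / S - 1.
have Hx : 0 < x by rewrite /x; have : 1 < A / S; [apply/Rlt_div_r; lra | lra].
have [m Hm] := INR_unbounded (K / x).
have HB := poly m x Hx.
have Hp : 0 < S ^ m by apply: pow_lt; lra.
have E : A ^ m = (1 + x) ^ m * S ^ m by rewrite -Rpow_mult_distr; congr (_ ^ _); rewrite /x; field.
have := H m; rewrite E => H1.
have H2 := Rmult_le_reg_r _ _ _ Hp H1.
have : K < INR m * x by apply/Rlt_div_l; lra.
lra.
Qed.

(* Cauchy's formula for F^m loses only a factor independent of m; let m tend to infinity. *)
Lemma holo_max_principle F z r S : holo in_disk F -> Cmod z < r < 1 ->
  (forall w, Cmod w = r -> Cmod (F w) <= S) -> Cmod (F z) <= S.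
Proof.
move=> HF Hr HS; have Hz0 := Cmod_ge_0 z; have HP := PI_RGT_0.
have Ar : Rabs r = r by rewrite Rabs_pos_eq; lra.
have HS0 : 0 <= S by apply: Rle_trans (HS (circ r 0) _); [exact: Cmod_ge_0 | rewrite Cmod_circ].
(* The factor 2 is [4 PI] from [CInt_bound] over the kernel integral [2 PI]; [r / (r - |z|)] bounds
   the kernel. *)
apply: (pow_bound_le _ _ (2 * (r / (r - Cmod z)))) => // [|m]; first exact: Cmod_ge_0.
have := CInt_cauchy _ z r (holo_pow _ _ m HF) Hr.
rewrite CInt_ckernel; last lra.
move=> E; have := f_equal Cmod E; rewrite Cmod_mult Cmod_pow Cmod_R (Rabs_pos_eq (2 * PI)); last lra.
move=> E2.
have : Cmod (CInt (fun u => F (circ r u) ^ m * ckernel r z u)%C) <= 4 * PI * (S ^ m * (r / (r - Cmod z))).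
{ apply: CInt_bound => t.
  - apply: continuous_Cmult; last by apply: continuous_ckernel; lra.
    apply: continuous_Cpow; apply: Rcont_circ_comp => //; lra.
  - move=> _; have Nz : (circ r t - z <> 0)%C by apply: circ_minus_neq0; lra.
    rewrite Cmod_mult Cmod_pow Cmod_div // Cmod_circ Ar.
    apply: Rmult_le_compat.
    + apply: pow_le; exact: Cmod_ge_0.
    + apply: Rdiv_le_0_compat; [lra | exact/Cmod_gt_0].
    + apply: pow_incr; split; [exact: Cmod_ge_0 | apply: HS; by rewrite Cmod_circ].
    + apply: Rmult_le_compat_l; first lra.
      apply: Rinv_le_contravar; first lra.
      have := Cmod_triangle (circ r t - z) z.
      rewrite (_ : circ r t - z + z = circ r t)%C; last ring.
      rewrite Cmod_circ; lra. }
rewrite E2 => H; nra.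
Qed.

(** * The inverse of [w e^w] *)

Lemma exp_le_compat x y : x <= y -> exp x <= exp y.
Proof. by case=> [H|->]; [apply: Rlt_le; exact: exp_increasing | right]. Qed.

(** The mean value theorem is real, so it is applied along the segment to the real part of
    [conj D * cexp], whose total increment is [|D|^2]; dividing by [|D|] gives the claim. *)
Lemma cexp_lipschitz u v : Cmod u <= 1 -> Cmod v <= 1 ->
  Cmod (cexp u - cexp v) <= exp 1 * Cmod (u - v).
Proof.
move=> Hu Hv; set D := (cexp u - cexp v)%C.
have HD l : Rcderiv (fun l => Cconj D * cexp (v + RtoC l * (u - v)))%C l (Cconj D * cexp (v + RtoC l * (u - v)) * (u - v))%C.
{ apply: (Rcderiv_comp (fun z => Cconj D * cexp z)%C (fun l => v + RtoC l * (u - v))%C);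
    [exact: cderiv_scal (cderiv_cexp _) | exact: Rcderiv_affine]. }
have [l [Hl E]] := MVT_gen (fun l => fst (Cconj D * cexp (v + RtoC l * (u - v)))%C) 0 1 _
  (fun l _ => Rcderiv_is_derive_fst _ _ _ (HD l))
  (fun l _ => proj2 (continuity_pt_filterlim _ _) (continuous_Re _ _ (Rcderiv_continuous _ _ _ (HD l)))).
rewrite Rmin_left in Hl; last lra. rewrite Rmax_right in Hl; last lra.
rewrite (_ : v + 1 * (u - v) = u)%C in E; last ring.
rewrite (_ : v + 0 * (u - v) = v)%C in E; last ring.
have HDD : Cmod D ^ 2 = fst (Cconj D * cexp u)%C - fst (Cconj D * cexp v)%C.
{ have -> : fst (Cconj D * cexp u)%C - fst (Cconj D * cexp v)%C = fst (Cconj D * D)%C by rewrite /D; simpl; ring.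
  rewrite Cmod2_alt /Re /Im; simpl; ring. }
rewrite E Rminus_0_r Rmult_1_r in HDD.
have H1 : Cmod D ^ 2 <= Cmod D * (exp 1 * Cmod (u - v)).
{ rewrite HDD; apply: Rle_trans (Rle_abs _) _; apply: Rle_trans (re_le_Cmod (Cconj D * cexp (v + RtoC l * (u - v)) * (u - v))%C) _.
  rewrite !Cmod_mult Cmod_conj Cmod_cexp Rmult_assoc.
  apply: Rmult_le_compat_l; first exact: Cmod_ge_0.
  apply: Rmult_le_compat_r; first exact: Cmod_ge_0.
  apply: exp_le_compat.
  have Bu := Rle_trans _ _ _ (Rle_abs _) (Rle_trans _ _ _ (re_le_Cmod u) Hu).
  have Bv := Rle_trans _ _ _ (Rle_abs _) (Rle_trans _ _ _ (re_le_Cmod v) Hv).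
  rewrite /Re in Bu Bv; simpl; nra. }
have HD0 := Cmod_ge_0 D.
case: (Req_dec (Cmod D) 0) => [->|N]; last by apply: (Rmult_le_reg_l (Cmod D)); lra.
apply: Rmult_le_pos; [exact: Rlt_le (exp_pos 1) | exact: Cmod_ge_0].
Qed.

Lemma Cmod_cexp_le z : Cmod z <= 1 -> Cmod (cexp z) <= exp 1.
Proof.
move=> Hz; rewrite Cmod_cexp; apply: exp_le_compat.
exact: (Rle_trans _ _ _ (Rle_abs _) (Rle_trans _ _ _ (re_le_Cmod z) Hz)).
Qed.

(* For e |y| < 1 the map w |-> y e^{-w} contracts the closed unit disk; its fixed point solves w e^w = y. *)
Lemma contraction_lipschitz y w v : Cmod w <= 1 -> Cmod v <= 1 ->
  Cmod (y * cexp (- w) - y * cexp (- v)) <= exp 1 * Cmod y * Cmod (w - v).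
Proof.
move=> Hw Hv.
have -> : (y * cexp (- w) - y * cexp (- v) = y * (cexp (- w) - cexp (- v)))%C by ring.
rewrite Cmod_mult (Rmult_comm (exp 1)) Rmult_assoc; apply: Rmult_le_compat_l; first exact: Cmod_ge_0.
have -> : Cmod (w - v) = Cmod (- w - - v) by rewrite -Cmod_opp; congr Cmod; ring.
by apply: cexp_lipschitz; rewrite Cmod_opp.
Qed.

Lemma lambert_exists y : exp 1 * Cmod y < 1 ->
  exists w, Cmod w < 1 /\ w = (y * cexp (- w))%C.
Proof.
move=> Hy; have Hy0 := Cmod_ge_0 y; have He := exp_pos 1.
set q := exp 1 * Cmod y; have Hq : 0 <= q < 1 by split => //; apply: Rmult_le_pos; lra.
have HT z : Cmod z <= 1 -> Cmod (y * cexp (- z)) <= q.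
{ move=> Hz; rewrite Cmod_mult Rmult_comm; apply: Rmult_le_compat_r => //.
  by apply: Cmod_cexp_le; rewrite Cmod_opp. }
(* Picard iteration from 0; its limit is obtained as the sum of the telescoping series of
   increments, dominated by [q^k]. *)
pose w := fix w k := match k with O => RtoC 0 | S j => (y * cexp (- w j))%C end.
have Hw k : Cmod (w k) <= 1.
{ elim: k => [|k IH] /=; first by rewrite Cmod_0; lra.
  have := HT _ IH; lra. }
have Hd k : Cmod (w (S k) - w k)%C <= q ^ k.
{ elim: k => [|k IH].
  - rewrite (_ : w 1%nat - w 0%nat = w 1%nat)%C; [exact: Hw | simpl; ring].
  - apply: Rle_trans (contraction_lipschitz y (w (S k)) (w k) (Hw _) (Hw _)) _.
    rewrite -/q /=; apply: Rmult_le_compat_l; [lra | exact: IH]. }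
have [l Hl] : exists l : C, is_Cseries (fun k => w (S k) - w k)%C l.
{ apply: ex_Cseries_le Hd _; apply: ex_series_geom; rewrite Rabs_pos_eq; lra. }
have Hs n : sum_n (G := C_AbelianMonoid) (fun k => w (S k) - w k)%C n = w (S n).
{ elim: n => [|n IH]; first by rewrite sum_O; simpl; ring.
  rewrite sum_Sn IH /plus; simpl; ring. }
have Hlim e : 0 < e -> exists n, Cmod (w n - l) < e /\ Cmod (w (S n) - l) < e.
{ move=> Hep; have [N HN] := proj1 (is_Cseries_Cmod _ _) Hl e Hep.
  exists (S N); rewrite -!Hs; split; apply: HN; lia. }
have Hl1 : Cmod l <= 1.
{ apply: Rnot_lt_le => Hlt; have [n [Hn _]] := Hlim (Cmod l - 1) ltac:(lra).
  have := Cmod_triangle (w n) (- (w n - l)); rewrite Cmod_opp (_ : w n + - (w n - l) = l)%C; last ring.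
  have := Hw n; lra. }
have Hfix : l = (y * cexp (- l))%C.
{ have E : Cmod (l - y * cexp (- l)) = 0.
  { apply: Rle_antisym; last exact: Cmod_ge_0.
    apply: Rnot_lt_le => Hlt; have [n [H1 H2]] := Hlim (Cmod (l - y * cexp (- l)) / 2) ltac:(lra).
    have H3 := contraction_lipschitz y (w n) l (Hw n) Hl1.
    have := Cmod_triangle (w (S n) - y * cexp (- l)) (- (w (S n) - l)).
    rewrite Cmod_opp (_ : w (S n) - y * cexp (- l) + - (w (S n) - l) = l - y * cexp (- l))%C; last ring.
    rewrite -/q in H3.
    change (w (S n)) with (y * cexp (- w n))%C in *.
    have := Cmod_ge_0 (w n - l); nra. }
  have := Cmod_eq_0 _ E => E2.
  by rewrite -[RHS]Cplus_0_l -E2; ring. }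
(* The limit is only known to lie in the closed disk; the fixed-point equation gives
   [|l| <= q < 1]. *)
exists l; split => //; rewrite Hfix; have := HT l Hl1; lra.
Qed.

(** Fixed points of nearby contractions are close. This makes [W] continuous although its values are
    selected independently for each [y]. *)
Lemma lambert_lipschitz y x w v :
  Cmod w < 1 -> Cmod v < 1 -> w = (y * cexp (- w))%C -> v = (x * cexp (- v))%C ->
  Cmod (w - v) * (1 - exp 1 * Cmod x) <= exp 1 * Cmod (y - x).
Proof.
move=> Hw Hv Ew Ev.
have H1 := contraction_lipschitz x w v ltac:(lra) ltac:(lra).
have H2 : Cmod (w - v) <= Cmod (y - x) * Cmod (cexp (- w)) + Cmod (x * cexp (- w) - x * cexp (- v)).
{ rewrite -Cmod_mult; apply: Rle_trans (Cmod_triangle _ _); apply: Req_le; congr Cmod.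
  rewrite {1}Ew {1}Ev; ring. }
have H3 : Cmod (cexp (- w)) <= exp 1 by apply: Cmod_cexp_le; rewrite Cmod_opp; lra.
have := Cmod_ge_0 (y - x); nra.
Qed.

Definition lambert_domain (y : C) : Prop := exp 1 * Cmod y < 1.

(** The derivative of [w e^w] is [(1 + w) e^w], nonzero for [|w| < 1]; continuity of the selected
    inverse then gives its differentiability. *)
Lemma lambert_function : exists W : C -> C, holo lambert_domain W /\
  forall y, lambert_domain y -> Cmod (W y) < 1 /\ (W y * cexp (W y) = y)%C.
Proof.
have HC y : exists w, lambert_domain y -> Cmod w < 1 /\ w = (y * cexp (- w))%C.
{ case: (Rlt_dec (exp 1 * Cmod y) 1) => [H|N]; last by exists 0%C.
  by have [w Hw] := lambert_exists y H; exists w. }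
have [W HW] : exists W : C -> C, forall y, lambert_domain y -> Cmod (W y) < 1 /\ W y = (y * cexp (- W y))%C.
{ exists (fun y => proj1_sig (constructive_indefinite_description _ (HC y))) => y.
  exact: (proj2_sig (constructive_indefinite_description _ (HC y))). }
have He := exp_pos 1.
have HWe y : lambert_domain y -> (W y * cexp (W y) = y)%C.
{ move=> Hy; have [_ E] := HW y Hy; rewrite {1}E -Cmult_assoc -cexp_plus.
  rewrite (_ : - W y + W y = 0)%C; last ring. by rewrite cexp_0 Cmult_1_r. }
exists W; split; last by move=> y Hy; split; [exact: (proj1 (HW y Hy)) | exact: HWe].
have Hopen y : lambert_domain y -> locally (T := C_UniformSpace) y lambert_domain.
{ move=> Hy; apply/locally_C_Cmod; rewrite /lambert_domain in Hy *.
  exists ((1 - exp 1 * Cmod y) / exp 1); split; first by apply: Rdiv_lt_0_compat; lra.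
  move=> x /Rlt_div_r Hx; have := Hx He.
  have := Cmod_triangle (x - y) y; rewrite (_ : x - y + y = x)%C; last ring.
  nra. }
have Hcont y : lambert_domain y -> continuous W y.
{ move=> Hy; have [Hy1 Hy2] := HW y Hy; apply/continuous_C_Cmod => e Hep.
  have [d [Hd Hx]] := proj1 (locally_C_Cmod _ _) (Hopen y Hy).
  rewrite /lambert_domain in Hy.
  set m := 1 - exp 1 * Cmod y; have Hm : 0 < m by rewrite /m; lra.
  have Hd2 : 0 < e * m / exp 1 by apply: Rdiv_lt_0_compat => //; apply: Rmult_lt_0_compat.
  exists (Rmin d (e * m / exp 1)); split; first exact: Rmin_pos.
  move=> x Hxy; have L1 := Rmin_l d (e * m / exp 1); have L2 := Rmin_r d (e * m / exp 1).
  have [Hx1 Hx2] := HW x (Hx x ltac:(lra)).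
  have := lambert_lipschitz x y _ _ Hx1 Hy1 Hx2 Hy2; rewrite -/m => H.
  have : Cmod (x - y) * exp 1 < e * m by apply/Rlt_div_r => //; lra.
  move=> H2; apply: (Rmult_lt_reg_r m) => //; lra. }
exists (fun y => / ((1 + W y) * cexp (W y)))%C => y Hy.
have [Hy1 Hy2] := HW y Hy.
have N : ((1 + W y) * cexp (W y) <> 0)%C.
{ apply: Cmult_neq_0; last exact: cexp_neq0.
  move=> E; have : W y = (- (1))%C by rewrite (_ : W y = 1 + W y - 1)%C; [rewrite E; ring | ring].
  move=> E2; rewrite E2 Cmod_m1 in Hy1; lra. }
split; last first.
{ apply: continuous_Cinv => //; apply: continuous_Cmult.
  - apply: continuous_Cplus; [exact: continuous_const | exact: Hcont].
  - apply: continuous_cexp; exact: Hcont. }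
(* [Phi] is a slope function of [w e^w] at [W y]; since [W] inverts [w e^w], [/ Phi (W x)] is a
   slope function of [W] at [y]. *)
have [Phi [Pc [Pz Pl]]] := cderiv_mult _ _ _ _ _ (cderiv_id (W y)) (cderiv_cexp (W y)).
have PW : continuous (fun x => Phi (W x)) y by apply: (continuous_comp W Phi); [exact: Hcont |].
have Ez : (1 * cexp (W y) + W y * cexp (W y) = (1 + W y) * cexp (W y))%C by ring.
rewrite Ez in Pz.
have NP : Phi (W y) <> 0%C by rewrite Pz.
have Pl' : locally (T := C_UniformSpace) y (fun x => W x * cexp (W x) = W y * cexp (W y) + Phi (W x) * (W x - W y))%C := Hcont y Hy _ Pl.
exists (fun x => / Phi (W x))%C; split; first exact: continuous_Cinv.
split; first by rewrite Pz.
apply: filter_imp (filter_and _ _ (Hopen y Hy) (filter_and _ _ (locally_neq0 _ _ PW NP) Pl')) => x [Hx [Nx E]].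
rewrite (HWe x Hx) (HWe y Hy) in E.
move: Nx E; move: (Phi (W x)) => p; move: (W x) => v Nx ->; cfield; exact: Nx.
Qed.

(** * Functions with [Re (z f' / f) < beta] *)

Lemma locally_in_disk z : in_disk z -> locally (T := C_UniformSpace) z in_disk.
Proof.
rewrite /in_disk => Hz; apply/locally_C_Cmod; exists (1 - Cmod z); split; first lra.
move=> x Hx; have := Cmod_triangle (x - z) z; rewrite (_ : x - z + z = x)%C; [lra | ring].
Qed.

Lemma Cplus_eq_reg_l (a x y : C) : (a + x = a + y -> x = y)%C.
Proof. move=> E; rewrite (_ : x = a + x - a)%C; [rewrite E; ring | ring]. Qed.

Lemma in_disk_0 : in_disk 0.
Proof. rewrite /in_disk Cmod_0; lra. Qed.

Lemma holo_in_disk_ext F G : (forall z, in_disk z -> F z = G z) -> holo in_disk F -> holo in_disk G.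
Proof.
move=> H [F' HF]; exists F' => z Hz; have [H1 H2] := HF z Hz; split => //.
apply: cderiv_ext_loc H1; apply: filter_imp (locally_in_disk z Hz) => x; exact: H.
Qed.

Lemma psum_decr a z : coef_bounded a -> in_disk z ->
  psum a z = (a 0%nat + z * psum (fun k => a (S k)) z)%C.
Proof.
move=> Ha Hz.
have H1 := is_Cpseries_incr_1 _ _ _ (psum_correct a z Ha Hz).
have H2 := proj1 (is_Cpseries_mult _ _ _) (psum_correct _ z (coef_bounded_incr a 1 Ha) Hz).
have H3 := is_series_scal (K := C_AbsRing) (V := C_NormedModule) z _ _ H2.
have H4 : is_Cseries (fun k => a (S k) * z ^ S k)%C (z * psum (fun k => a (1 + k)%nat) z)%C.
{ apply: is_series_ext H3 => k; rewrite /scal /= /mult /=; cring. }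
have := is_Cseries_unique _ _ _ H1 H4; rewrite /= => <-; ring.
Qed.

Lemma psum_0 a : coef_bounded a -> psum a 0 = a 0%nat.
Proof. move=> Ha; rewrite (psum_decr a 0 Ha in_disk_0); ring. Qed.

Lemma psum_shift m a z : coef_bounded a -> in_disk z -> (forall k, (k < m)%nat -> a k = 0%C) ->
  psum a z = (z ^ m * psum (fun k => a (m + k)%nat) z)%C.
Proof.
move=> Ha Hz; elim: m a Ha => [|m IH] a Ha H0 /=; first by rewrite Cmult_1_l.
rewrite (psum_decr a z Ha Hz) H0; last lia.
rewrite (IH (fun k => a (S k)) (coef_bounded_incr a 1 Ha)); last by move=> k Hk; apply: H0; lia.
ring.
Qed.

Lemma analytic_disk_psum F : analytic_disk F ->
  exists a, coef_bounded a /\ forall z, in_disk z -> F z = psum a z.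
Proof.
move=> [a Ha]; exists a; split.
- by apply: coef_bounded_of_pseries => z Hz; exists (F z); exact: Ha.
- move=> z Hz; symmetry; exact: psum_unique (Ha z Hz).
Qed.

Lemma class_A_psum n f : class_A n f -> exists b, coef_bounded b /\ b 0%nat = 0%C /\ b 1%nat = 1%C /\
  (forall k, (2 <= k <= n)%nat -> b k = 0%C) /\ forall z, in_disk z -> f z = psum b z.
Proof.
move=> [b [b0 [b1 [bn Hb]]]]; exists b; repeat split => //.
- by apply: coef_bounded_of_pseries => z Hz; exists (f z); exact: Hb.
- move=> z Hz; symmetry; exact: psum_unique (Hb z Hz).
Qed.

(** Writing [f = z g] gives [z f'/f = 1 + z g'/g]. The gap in the coefficients of [f] lets [z^(n-1)]
    be factored out of [g'], which produces the zero of order [n] as a holomorphic factorisation,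
    without division by [z]. *)
Lemma class_A_factor n f : (1 <= n)%nat -> class_A n f -> exists g g' k,
  (forall z, in_disk z -> f z = z * g z)%C /\ g 0%C = 1%C /\ holo in_disk g /\
  (forall z, in_disk z -> cderiv g z (g' z)) /\ holo in_disk k /\
  forall z, in_disk z -> (z * g' z = z ^ n * k z)%C.
Proof.
move=> Hn /class_A_psum [b [Hb [b0 [b1 [bn Hf]]]]].
have Ha := coef_bounded_incr b 1 Hb; have Hd := coef_bounded_deriv _ Ha.
exists (psum (fun k => b (1 + k)%nat)), (psum (deriv_coef (fun k => b (1 + k)%nat))).
exists (psum (fun k => deriv_coef (fun k => b (1 + k)%nat) (n - 1 + k)%nat)).
split; last split; last split; last split; last split.
- move=> z Hz; rewrite Hf // psum_decr // b0 /=; ring.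
- by rewrite psum_0.
- exact: holo_psum.
- move=> z Hz; exact: cderiv_psum.
- apply: holo_psum; exact: coef_bounded_incr.
- move=> z Hz; rewrite (psum_shift (n - 1) _ z Hd Hz).
  + rewrite Cmult_assoc -Cpow_S; do 2 f_equal; lia.
  (* Dividing by [z] and differentiating each shift the index by one: coefficient [k] of [g'] is a
     multiple of [b (k + 2)]. *)
  + move=> k Hk; rewrite /deriv_coef (bn (1 + S k)%nat); [ring | lia].
Qed.

Lemma zf'f_0 f : zf'f f 0 = 1%C.
Proof. by rewrite /zf'f /Re /Im /=; case: Req_EM_T => // ?; case: Req_EM_T. Qed.

Lemma zf'f_neq0 f (z : C) : z <> 0%C -> zf'f f z = (z * C_derive f z / f z)%C.
Proof.
move=> Hz; rewrite /zf'f; case: (Req_EM_T (Re z) 0) => [E1|//]; case: (Req_EM_T (Im z) 0) => [E2|//].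
by case: Hz; apply: injective_projections.
Qed.

Lemma zf'f_factor f g (z l : C) : in_disk z -> (forall x, in_disk x -> f x = x * g x)%C ->
  cderiv g z l -> g z <> 0%C -> zf'f f z = (1 + z * l / g z)%C.
Proof.
move=> Hz Hf Hg N; case: (Req_dec (Cmod z) 0) => [/Cmod_eq_0 ->|Nz].
{ rewrite zf'f_0 /Cdiv !Cmult_0_l; ring. }
have {}Nz : z <> 0%C by move=> E; apply: Nz; rewrite E Cmod_0.
rewrite zf'f_neq0 // Hf //.
rewrite (cderiv_C_derive f z (1 * g z + z * l)); first by field.
apply: (cderiv_ext_loc (fun x => x * g x)%C); last exact: cderiv_mult (cderiv_id z) Hg.
apply: filter_imp (locally_in_disk z Hz) => x Hx; by rewrite Hf.
Qed.

(** * Dilations *)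

Lemma in_disk_scale r (z : C) : 0 < r <= 1 -> in_disk z -> in_disk (RtoC r * z).
Proof.
rewrite /in_disk => Hr Hz; rewrite Cmod_mult Cmod_R Rabs_pos_eq; last lra.
have := Cmod_ge_0 z; nra.
Qed.

Lemma RtoC_neq0 r : r <> 0 -> RtoC r <> 0%C.
Proof. by move=> H E; apply: H; exact: (f_equal fst E). Qed.

Lemma zf'f_dilate n f r (z : C) : class_A n f -> 0 < r <= 1 -> in_disk z ->
  zf'f (dilate r f) z = zf'f f (RtoC r * z).
Proof.
move=> /class_A_psum [b [Hb [_ [_ [_ Hf]]]]] Hr Hz.
have Nr : RtoC r <> 0%C by apply: RtoC_neq0; lra.
case: (Req_dec (Cmod z) 0) => [/Cmod_eq_0 ->|Nz].
{ by rewrite Cmult_0_r !zf'f_0. }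
have {}Nz : z <> 0%C by move=> E; apply: Nz; rewrite E Cmod_0.
have Hrz := in_disk_scale r z Hr Hz.
have [f' Hf'] := holo_in_disk_ext _ f (fun z Hz => eq_sym (Hf z Hz)) (holo_psum b Hb).
have {Hf'} [Hf' _] := Hf' _ Hrz.
have Hd : cderiv (dilate r f) z (f' (RtoC r * z)%C).
{ have := cderiv_scal (/ RtoC r)%C _ _ _ (cderiv_comp f (fun x => RtoC r * x)%C z _ _ Hf' (cderiv_scal (RtoC r) _ _ _ (cderiv_id z))).
  rewrite (_ : / RtoC r * (f' (RtoC r * z) * (RtoC r * 1)) = f' (RtoC r * z))%C; last by field.
  apply: cderiv_ext_loc; apply: filter_forall => x; rewrite /dilate; cfold; rewrite /Cdiv; ring. }
rewrite !zf'f_neq0 //; last exact: Cmult_neq_0.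
rewrite (cderiv_C_derive _ _ _ Hd) (cderiv_C_derive _ _ _ Hf') /dilate.
(* If [f] vanishes at [r z], both sides divide by zero and agree because [/ 0 = 0] in [C]. *)
case: (Ceq_dec (f (RtoC r * z)%C) 0%C) => [->|Nf]; last by field.
have E : (/ RtoC 0 = 0)%C by rewrite /Cinv /=; apply: injective_projections => /=; rewrite /Rdiv; ring.
rewrite (_ : 0 / RtoC r = 0)%C; last by rewrite /Cdiv; ring.
by rewrite /Cdiv E; ring.
Qed.

Lemma class_A_dilate n f r : class_A n f -> 0 < r <= 1 -> class_A n (dilate r f).
Proof.
move=> [b [b0 [b1 [bn Hb]]]] Hr; have Nr : RtoC r <> 0%C by apply: RtoC_neq0; lra.
(* These are [b k r^(k - 1)], written so that index 0 involves no truncated subtraction. *)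
exists (fun k => / RtoC r * (b k * RtoC r ^ k))%C; split; last split; last split.
- rewrite b0; ring.
- rewrite b1 /=; field; exact: Nr.
- move=> k Hk; rewrite bn //; ring.
- move=> z Hz; have H := proj1 (is_Cpseries_mult _ _ _) (Hb _ (in_disk_scale r z Hr Hz)).
  apply/is_Cpseries_mult.
  have := is_series_scal (K := C_AbsRing) (V := C_NormedModule) (/ RtoC r)%C _ _ H.
  rewrite (_ : scal _ _ = dilate r f z); last by rewrite /dilate /scal /= /mult /= /Cdiv; cring.
  apply: is_series_ext => k; rewrite Cpow_mult_l /scal /= /mult /=; cring.
Qed.

Lemma nonvanishing_dilate f r : nonvanishing f -> 0 < r <= 1 -> nonvanishing (dilate r f).
Proof.
move=> Hf Hr z Hz Nz; have Nr : RtoC r <> 0%C by apply: RtoC_neq0; lra.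
have H := Hf _ (in_disk_scale r z Hr Hz) (Cmult_neq_0 _ _ Nr Nz).
rewrite /dilate => E; apply: H.
rewrite (_ : f (RtoC r * z) = RtoC r * (f (RtoC r * z) / RtoC r))%C; last by field.
rewrite E; ring.
Qed.

(** * Schwarz's lemma and the growth of [z f'/f - 1] *)

(** Points to the left of the line [Re = B] are closer to 0 than to its mirror image [2 B]. *)
Lemma Cmod_lt_reflect (h : C) B : 0 < B -> Re h < B -> Cmod h < Cmod (h - RtoC (2 * B)).
Proof.
move=> HB Hh; have H1 := Cmod2_alt h; have H2 := Cmod2_alt (h - RtoC (2 * B)).
have P1 := Cmod_ge_0 h; have P2 := Cmod_ge_0 (h - RtoC (2 * B)).
move: H1 H2; rewrite /Re /Im in Hh *; simpl => H1 H2.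
apply: Rnot_le_lt => Hle; nra.
Qed.

(** On [|w| = r] the hypothesis gives [|psi w| <= 1 / r^n]; the maximum principle carries this to
    [z], and [r] tends to 1. *)
Lemma schwarz_pow psi n : (1 <= n)%nat -> holo in_disk psi ->
  (forall z, in_disk z -> Cmod (z ^ n * psi z) <= 1) -> forall z, in_disk z -> Cmod (psi z) <= 1.
Proof.
move=> Hn Hpsi Hb z Hz; rewrite /in_disk in Hz; have Hz0 := Cmod_ge_0 z.
have HP0 := Cmod_ge_0 (psi z).
have H r : Cmod z < r < 1 -> Cmod (psi z) * r ^ n <= 1.
{ move=> Hr; have Hp : 0 < r ^ n by apply: pow_lt; lra.
  apply: (proj2 (Rle_div_r _ 1 _ Hp)).
  apply: (holo_max_principle psi z r) => // w Hw.
  apply: (proj1 (Rle_div_r _ 1 _ Hp)).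
  have := Hb w; rewrite /in_disk Cmod_mult Cmod_pow Hw => H; have {}H := H (proj2 Hr); lra. }
(* The radii [1 - (1 - |z|) / 2^(k+1)] lie strictly between [|z|] and 1 and increase to 1. *)
have HL : is_lim_seq (fun k => Cmod (psi z) * (1 - (1 - Cmod z) / 2 * (1 / 2) ^ k) ^ n)
   (Cmod (psi z) * (1 - (1 - Cmod z) / 2 * 0) ^ n).
{ apply: is_lim_seq_mult'; first exact: is_lim_seq_const.
  have X : is_lim_seq (fun k => 1 - (1 - Cmod z) / 2 * (1 / 2) ^ k) (1 - (1 - Cmod z) / 2 * 0).
  { apply: is_lim_seq_minus'; first exact: is_lim_seq_const.
    apply: is_lim_seq_mult'; first exact: is_lim_seq_const.
    apply: is_lim_seq_geom; rewrite Rabs_pos_eq; lra. }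
  elim: n {Hn Hb H} => [|n IH] /=; first exact: is_lim_seq_const.
  exact: is_lim_seq_mult'. }
have := is_lim_seq_le _ _ _ 1 (fun k => H _ _) HL (is_lim_seq_const 1).
rewrite Rmult_0_r Rminus_0_r pow1 Rmult_1_r; apply => k.
have Hk : 0 < (1 / 2) ^ k <= 1.
{ split; first by apply: pow_lt; lra. rewrite -{2}(pow1 k); apply: pow_incr; lra. }
nra.
Qed.

Lemma starlike_ratio n beta f : (1 <= n)%nat -> 1 < beta -> M_n n beta f ->
  exists h, holo in_disk h /\ (forall z, in_disk z -> zf'f f z = 1 + h z)%C /\
    forall z, in_disk z -> Cmod (h z) * (1 - Cmod z ^ n) <= 2 * (beta - 1) * Cmod z ^ n.
Proof.
move=> Hn Hbeta [HA [Hnv Hre]].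
have [g [g' [k [Hf [g0 [Hg [Hg' [Hk Hzk]]]]]]]] := class_A_factor n f Hn HA.
set B := beta - 1; have HB : 0 < B by rewrite /B; lra.
have Ng z : in_disk z -> g z <> 0%C.
{ move=> Hz; case: (Ceq_dec z 0) => [->|Nz]; first by rewrite g0; apply: RtoC_neq0; lra.
  move=> E; apply: (Hnv z Hz Nz); rewrite Hf // E; ring. }
pose h z := (z ^ n * (k z * / g z))%C.
have Hh z : in_disk z -> zf'f f z = (1 + h z)%C.
{ move=> Hz; rewrite (zf'f_factor f g z _ Hz Hf (Hg' z Hz) (Ng z Hz)) Hzk // /h /Cdiv; ring. }
have Hkg : holo in_disk (fun z => k z * / g z)%C by apply: holo_mult => //; exact: holo_inv.
have Hhol : holo in_disk h by apply: holo_mult => //; apply: holo_pow; exact: holo_id.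
have Hlt z : in_disk z -> Cmod (h z) < Cmod (h z - RtoC (2 * B)).
{ move=> Hz; apply: Cmod_lt_reflect => //.
  have := Hre z Hz; rewrite Hh // /Re /B; simpl; lra. }
have Nh z : in_disk z -> (h z - RtoC (2 * B) <> 0)%C.
{ move=> Hz; apply/Cmod_gt_0; have := Hlt z Hz; have := Cmod_ge_0 (h z); lra. }
(* This is [h / (h - 2 B)] divided by [z^n], with the factor [z^n] of [h] removed beforehand so that
   [psi] is holomorphic at 0 as well. *)
pose psi z := (k z * / g z * / (h z - RtoC (2 * B)))%C.
have Hpsi : holo in_disk psi.
{ apply: holo_mult => //; apply: holo_inv => //.
  apply: holo_plus => //; exact: holo_const. }
have Ephi z : in_disk z -> (z ^ n * psi z * (h z - RtoC (2 * B)) = h z)%C.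
{ move=> Hz; rewrite /psi {3}/h; field; split; solve [exact: Nh | exact: Ng]. }
have Hpsi1 := schwarz_pow psi n Hn Hpsi.
exists h; split => //; split => // z Hz.
have {}Hpsi1 : Cmod (psi z) <= 1.
{ apply: Hpsi1 => // w Hw; have H1 := Hlt w Hw; have H2 := Cmod_ge_0 (h w).
  have := f_equal Cmod (Ephi w Hw); rewrite Cmod_mult => E.
  apply: (Rmult_le_reg_r (Cmod (h w - RtoC (2 * B)))); lra. }
have := f_equal Cmod (Ephi z Hz); rewrite Cmod_mult (Cmod_mult _ (psi z)) Cmod_pow => E.
have H3 : Cmod (h z - RtoC (2 * B)) <= Cmod (h z) + 2 * B.
{ apply: Rle_trans (Cmod_triangle _ _) _; rewrite Cmod_opp Cmod_R Rabs_pos_eq; lra. }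
have Hx : 0 <= Cmod z ^ n by apply: pow_le; exact: Cmod_ge_0.
have P1 := Cmod_ge_0 (psi z); have P2 := Cmod_ge_0 (h z - RtoC (2 * B)).
have H4 : Cmod z ^ n * Cmod (psi z) <= Cmod z ^ n by nra.
have H5 : Cmod z ^ n * Cmod (psi z) * Cmod (h z - RtoC (2 * B)) <= Cmod z ^ n * (Cmod (h z) + 2 * B).
{ apply: Rmult_le_compat => //; exact: Rmult_le_pos. }
lra.
Qed.

Lemma M_n_dilate_subordinate n beta f r : (1 <= n)%nat -> 1 < beta -> M_n n beta f ->
  0 < r <= 1 -> r ^ n * (2 * exp 1 * (beta - 1) + 1) <= 1 -> S_wp_n n (dilate r f).
Proof.
move=> Hn Hbeta HM Hr Hrn.
have [h [Hh [Hzf Hb]]] := starlike_ratio n beta f Hn Hbeta HM.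
move: HM => [HA [Hnv _]].
have [W [HW HWe]] := lambert_function.
have Hdom z : in_disk z -> lambert_domain (h (RtoC r * z)%C).
{ move=> Hz; have Hrz := in_disk_scale r z Hr Hz; have := Hb _ Hrz.
  rewrite /lambert_domain Cmod_mult Cmod_R Rabs_pos_eq; last lra.
  rewrite Rpow_mult_distr; set x := r ^ n * Cmod z ^ n => H.
  have Hrp : 0 < r ^ n by apply: pow_lt; lra.
  have Hzn : 0 <= Cmod z ^ n < 1.
  { have Hz0 := Cmod_ge_0 z; rewrite /in_disk in Hz; apply: pow_lt_1_compat; [lra | lia]. }
  have He := exp_pos 1.
  have Hx0 : 0 <= x by apply: Rmult_le_pos; lra.
  (* The hypothesis on [r] allows equality; strictness comes from [|z| < 1]. *)
  have Hx1 : x * (2 * exp 1 * (beta - 1) + 1) < 1.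
  { have HK : 0 < 2 * exp 1 * (beta - 1) + 1 by nra.
    rewrite /x; have : 0 < r ^ n * (2 * exp 1 * (beta - 1) + 1) by exact: Rmult_lt_0_compat.
    nra. }
  have HB : 0 < exp 1 * (beta - 1) by apply: Rmult_lt_0_compat; lra.
  have Hx2 : x < 1 by nra.
  apply: (Rmult_lt_reg_r (1 - x)); first lra.
  apply: (Rle_lt_trans _ (exp 1 * (2 * (beta - 1) * x))); last lra.
  rewrite Rmult_assoc; apply: Rmult_le_compat_l; lra. }
split; first exact: class_A_dilate.
split; first exact: nonvanishing_dilate.
exists (fun z => W (h (RtoC r * z)%C)); split; last split; last split.
- apply: holo_in_disk_analytic; apply: (holo_comp _ lambert_domain W) => //.
  apply: (holo_comp _ in_disk h) => //.
  + apply: holo_mult; [exact: holo_const | exact: holo_id].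
  + move=> z; exact: in_disk_scale.
- have E0 : h 0%C = 0%C.
  { apply: (Cplus_eq_reg_l 1%C); rewrite -(Hzf 0%C in_disk_0) zf'f_0; ring. }
  have D0 : lambert_domain 0 by rewrite /lambert_domain Cmod_0; lra.
  have [_ E] := HWe _ D0; rewrite Cmult_0_r E0.
  case: (Ceq_dec (W 0%C) 0%C) => // N; by case: (Cmult_neq_0 _ _ N (cexp_neq0 (W 0%C))).
- move=> z Hz; exact: (proj1 (HWe _ (Hdom z Hz))).
- move=> z Hz; rewrite (zf'f_dilate n) // Hzf; last exact: in_disk_scale.
  by rewrite /wp (proj2 (HWe _ (Hdom z Hz))).
Qed.

(* In the unit disk w e^w is real only for real w. *)
Lemma lambert_real_bound (w : C) y : Cmod w < 1 -> (w * cexp w)%C = RtoC (- y) -> exp 1 * y <= 1.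
Proof.
move=> Hw E; case: w Hw E => a b Hw E.
have E1 := f_equal fst E; have E2 := f_equal snd E; rewrite /cexp /Re /Im /= in E1 E2.
have Hm := Cmod2_alt (a, b); rewrite /Re /Im /= in Hm.
have Hm0 := Cmod_ge_0 (a, b).
have Hab : a * a + b * b < 1 by nra.
have Ha := exp_pos a.
have E3 : a * sin b + b * cos b = 0.
{ apply: (Rmult_eq_reg_l (exp a)); lra. }
have HSC := sin2_cos2 b; rewrite /Rsqr in HSC.
have Hs : sin b * sin b <= b * b.
{ have HPI := PI2_3_2; case: (Rtotal_order b 0) => [Hb|[->|Hb]].
  - have S1 := sin_lt_x (- b) ltac:(lra); have S2 := sin_gt_0 (- b) ltac:(lra) ltac:(nra).
    rewrite sin_neg in S1 S2; nra.
  - rewrite sin_0; lra.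
  - have S1 := sin_lt_x b Hb; have S2 := sin_gt_0 b Hb ltac:(nra); nra. }
(* Obtained by squaring [a sin b = - b cos b]. As [a^2 + b^2 < 1] and [sin^2 b <= b^2], it is
   impossible unless [b = 0]. *)
have Eb : (a * a + b * b) * (sin b * sin b) = b * b.
{ have X : a * sin b = - (b * cos b) by lra.
  have -> : (a * a + b * b) * (sin b * sin b) = (a * sin b) * (a * sin b) + b * b * (sin b * sin b) by ring.
  rewrite X -{2}(Rmult_1_r (b * b)) -HSC; ring. }
have Hb0 : b = 0.
{ have Hb2 : b * b <= 0.
  { apply: Rnot_lt_le => Hb; have : 0 < sin b * sin b by nra. nra. }
  nra. }
rewrite Hb0 cos_0 sin_0 in E1.
(* The tangent-line bound at [- 1 - a], multiplied by [e^a], reads [- a e^a <= 1/e], with equality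
   at [a = -1]. *)
have H := exp_ineq1_le (- 1 - a).
have Hx : exp (- 1 - a) * exp a = / exp 1 by rewrite -exp_plus -exp_Ropp; congr exp; ring.
have He := exp_pos 1.
have : y <= / exp 1 by nra.
move=> Hy; apply: (Rmult_le_reg_l (/ exp 1)); first exact: Rinv_0_lt_compat.
rewrite -Rmult_assoc Rinv_l; lra.
Qed.

(** * The extremal function *)

(* Coefficients of log (1 - u). *)
Definition log_coef (k : nat) : C :=
  match k with O => 0%C | S j => RtoC (- / INR (S j)) end.

Lemma coef_bounded_le_1 (a : nat -> C) : (forall k, Cmod (a k) <= 1) -> coef_bounded a.
Proof.
move=> Ha r Hr; exists 1 => k.
have H : 0 <= r ^ k <= 1.
{ split; first by apply: pow_le; lra. rewrite -(pow1 k); apply: pow_incr; lra. }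
have := Ha k; have := Cmod_ge_0 (a k); nra.
Qed.

Lemma coef_bounded_log : coef_bounded log_coef.
Proof.
apply: coef_bounded_le_1 => -[|k]; rewrite /log_coef; first by rewrite Cmod_0; lra.
have H : 1 <= INR (S k) by rewrite S_INR; have := pos_INR k; lra.
rewrite Cmod_R Rabs_Ropp Rabs_pos_eq; last by apply: Rlt_le; apply: Rinv_0_lt_compat; lra.
rewrite -Rinv_1; apply: Rinv_le_contravar; lra.
Qed.

Lemma one_minus_neq0 z : in_disk z -> (1 - z <> 0)%C.
Proof.
rewrite /in_disk => Hz E; have : z = 1%C by rewrite (_ : z = 1 - (1 - z))%C; [rewrite E; ring | ring].
move=> E2; rewrite E2 Cmod_1 in Hz; lra.
Qed.

(** The differentiated series [s] has all coefficients [-1], so it satisfies [s = - 1 + z s]. *)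
Lemma cderiv_psum_log z : in_disk z -> cderiv (psum log_coef) z (- / (1 - z)).
Proof.
move=> Hz; have N := one_minus_neq0 z Hz.
have Hd := coef_bounded_deriv _ coef_bounded_log.
have E k : deriv_coef log_coef k = (- (1))%C.
{ rewrite /deriv_coef /log_coef -RtoC_mult (_ : INR (S k) * - / INR (S k) = - 1).
  - by rewrite RtoC_opp.
  - field; exact: not_0_INR. }
have := cderiv_psum _ _ coef_bounded_log Hz.
rewrite (_ : psum (deriv_coef log_coef) z = - / (1 - z))%C //.
have := psum_decr _ z Hd Hz.
have -> : psum (fun k => deriv_coef log_coef (S k)) z = psum (deriv_coef log_coef) z.
{ by congr pair; apply: Series_ext => k; rewrite !E. }
rewrite E; set s := psum _ z => Es.
have {}Es : (s * (1 - z) = - (1))%C by rewrite (_ : s * (1 - z) = s - z * s)%C; [rewrite {1}Es; ring | ring].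
rewrite (_ : s = s * (1 - z) / (1 - z))%C; [rewrite Es | ]; by field.
Qed.

Lemma coef_bounded_decr m a : coef_bounded (fun k => a (m + k)%nat) -> coef_bounded a.
Proof.
move=> H r Hr; have [M HM] := H r Hr.
apply: (eventually_bounded _ m (M * r ^ m)) => k Hk.
rewrite (_ : k = (m + (k - m))%nat); last lia.
rewrite (Nat.add_comm m (k - m)) pow_add -Rmult_assoc (Nat.add_comm (k - m)).
apply: Rmult_le_compat_r; [apply: pow_le; lra | exact: HM].
Qed.

Lemma class_A_intro n (f q : C -> C) : (1 <= n)%nat -> holo in_disk q ->
  (forall z, in_disk z -> f z = (z * (1 + z ^ n * q z))%C) -> class_A n f.
Proof.
move=> Hn Hq Hf; have [s [Hs Es]] := analytic_disk_psum q (holo_in_disk_analytic q Hq).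
(* Coefficients 0 and 1 of the identity, zeros up to index [n], then [s] starting at index [n + 1];
   the test against [n] guards the truncated subtraction. *)
pose b k := match k with O => RtoC 0 | S O => RtoC 1
   | S (S j) => if Nat.leb (S (S j)) n then RtoC 0 else s (S j - n)%nat end.
have b0 k : (2 <= k <= n)%nat -> b k = 0%C.
{ case: k => [|[|j]] Hk; [lia | lia |]. by rewrite /b (proj2 (Nat.leb_le _ _) (proj2 Hk)). }
have bn k : b (S n + k)%nat = s k.
{ rewrite /b; case E : (S n + k)%nat => [|[|j]]; [lia | lia |].
  rewrite (proj2 (Nat.leb_gt _ _)); last lia. congr s; lia. }
have Hb : coef_bounded b.
{ apply: (coef_bounded_decr (S n)) => r Hr; have [M HM] := Hs r Hr; exists M => k; by rewrite bn. }
exists b; do 3 split => //.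
move=> z Hz; rewrite (_ : f z = psum b z); first exact: psum_correct.
have Hb1 := coef_bounded_incr b 1 Hb; have Hb2 := coef_bounded_incr b 2 Hb.
rewrite (psum_decr b z Hb Hz) (psum_decr _ z Hb1 Hz).
rewrite (psum_shift (n - 1) (fun k => b (S (S k))) z Hb2 Hz); last by move=> k Hk; apply: b0; lia.
rewrite (_ : psum (fun k => b (S (S (n - 1 + k)))) z = q z).
- rewrite Hf // (_ : z ^ n = z * z ^ (n - 1))%C; first by rewrite /=; ring.
  by rewrite -Cpow_S; congr (_ ^ _)%C; lia.
- rewrite Es //; congr pair; apply: Series_ext => k;
  by rewrite (_ : b (S (S (n - 1 + k))) = s k) // -bn; congr b; lia.
Qed.

(** The expression equals [2 B - 2 B / (1 - u)], and [1 / (1 - u)] maps the disk into [Re > 1/2]. *)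
Lemma Re_extremal_bound u B : in_disk u -> 0 < B -> Re (- RtoC (2 * B) * u / (1 - u)) < B.
Proof.
move=> Hu HB; have N := one_minus_neq0 u Hu.
have -> : (- RtoC (2 * B) * u / (1 - u) = RtoC (2 * B) - RtoC (2 * B) * / (1 - u))%C by field.
rewrite /in_disk in Hu; have Hm := Cmod2_alt u; rewrite /Re /Im in Hm *.
have Hm0 := Cmod_ge_0 u; simpl in Hm |- *.
set a := fst u in Hm *; set b := snd u in Hm *.
have Hab : a * a + b * b < 1 by nra.
set d := (1 + - a) * ((1 + - a) * 1) + (0 + - b) * ((0 + - b) * 1).
have Hd : 0 < d by rewrite /d; nra.
have : / 2 < (1 + - a) / d by apply/Rlt_div_r => //; rewrite /d; nra.
nra.
Qed.

(* f(z) = z (1 - z^n)^{2 (beta - 1) / n} *)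
Lemma extremal_function n beta : (1 <= n)%nat -> 1 < beta -> exists f, M_n n beta f /\
  forall z, in_disk z -> zf'f f z = (1 + - RtoC (2 * (beta - 1)) * z ^ n / (1 - z ^ n))%C.
Proof.
move=> Hn Hbeta; set B := beta - 1; have HB : 0 < B by rewrite /B; lra.
have Nn : INR n <> 0 by apply: not_0_INR; lia.
have NnC := RtoC_neq0 _ Nn.
(* The operator [z d/dz] sends [c log (1 - z^n)] to [- c n z^n / (1 - z^n)], so [c n] must be [2 B].
   The power is taken as an exponential of the logarithm series, hence never zero. *)
pose c := RtoC (2 * B / INR n).
pose P u := cexp (c * psum log_coef u)%C.
have HP : holo in_disk P.
{ apply: (holo_comp _ (fun _ => True) cexp) => //; first exact: holo_cexp.
  apply: holo_mult; [exact: holo_const | apply: holo_psum; exact: coef_bounded_log]. }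
have HP' u : in_disk u -> cderiv P u (P u * (c * - / (1 - u)))%C.
{ move=> Hu; apply: (cderiv_comp cexp); first exact: cderiv_cexp.
  apply: cderiv_scal; exact: cderiv_psum_log. }
have P0 : P 0%C = 1%C.
{ rewrite /P psum_0 /=; last exact: coef_bounded_log. by rewrite Cmult_0_r cexp_0. }
have Hzn z : in_disk z -> in_disk (z ^ n).
{ rewrite /in_disk Cmod_pow => Hz; apply: (proj2 (pow_lt_1_compat _ _ _ _)); last lia. split => //; exact: Cmod_ge_0. }
pose f z := (z * P (z ^ n))%C.
have Hf z : in_disk z -> zf'f f z = (1 + - RtoC (2 * B) * z ^ n / (1 - z ^ n))%C.
{ move=> Hz; have N := one_minus_neq0 _ (Hzn z Hz).
  have NP : P (z ^ n)%C <> 0%C by exact: cexp_neq0.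
  have En : n = S (n - 1) by lia.
  have Hd : cderiv (fun x => P (x ^ n))%C z (P (z ^ n) * (c * - / (1 - z ^ n)) * (RtoC (INR n) * z ^ (n - 1)))%C.
  { apply: (cderiv_comp P (fun x => x ^ n)%C); first exact: HP' (Hzn z Hz).
    have := cderiv_pow (n - 1) z; by rewrite -En. }
  rewrite (zf'f_factor f (fun x => P (x ^ n)%C) z _ Hz _ Hd NP) //.
  rewrite (_ : z * (P (z ^ n) * (c * - / (1 - z ^ n)) * (RtoC (INR n) * z ^ (n - 1))) / P (z ^ n)
     = - (c * RtoC (INR n)) * (z * z ^ (n - 1)) / (1 - z ^ n))%C; last by field.
  rewrite -Cpow_S -En /c -RtoC_mult (_ : 2 * B / INR n * INR n = 2 * B) //; by field. }
exists f; split => //; split; last split.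
(* As [P 0 = 1], splitting off the constant term of [P] and substituting [z^n] leaves [1 + z^n q],
   the form that [class_A_intro] expects. *)
- have [p [Hp Ep]] := analytic_disk_psum P (holo_in_disk_analytic P HP).
  apply: (class_A_intro n f (fun z => psum (fun k => p (S k)) (z ^ n)%C)) => //.
  + apply: (holo_comp _ in_disk (psum (fun k => p (S k)))) => //.
    * exact: holo_psum (coef_bounded_incr p 1 Hp).
    * apply: holo_pow; exact: holo_id.
  + move=> z Hz; rewrite /f Ep; last exact: Hzn.
    rewrite psum_decr //; last exact: Hzn.
    by rewrite -(psum_0 p Hp) -Ep ?P0 //; exact: in_disk_0.
- move=> z Hz Nz; apply: Cmult_neq_0 => //; exact: cexp_neq0.
- move=> z Hz; rewrite Hf //.
  have := Re_extremal_bound _ B (Hzn z Hz) HB; rewrite /Re /B; simpl; lra.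
Qed.

Theorem mainTheorem10 (n : nat) (beta : R) :
  (1 <= n)%nat -> 1 < beta ->
  is_sharp_radius (S_wp_n n) (M_n n beta)
    (Rpower (2 * exp 1 * (beta - 1) + 1) (- / INR n)).
Proof.
move=> Hn Hbeta; have He := exp_pos 1.
have HB : 0 < exp 1 * (beta - 1) by apply: Rmult_lt_0_compat; lra.
set K := 2 * exp 1 * (beta - 1) + 1; have HK : 1 < K by rewrite /K; lra.
set r0 := Rpower K _.
have Nn : INR n <> 0 by apply: not_0_INR; lia.
have Hr0 : 0 < r0 by exact: exp_pos.
(* Together with [r0 > 0] this identity is all that is used about the [Rpower] expression. *)
have Hr0n : r0 ^ n * K = 1.
{ rewrite -Rpower_pow // /r0 Rpower_mult (_ : - / INR n * INR n = - 1); last by field.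
  rewrite Rpower_Ropp Rpower_1; [field; lra | lra]. }
have Hr1 : r0 < 1.
{ apply: Rnot_le_lt => H; have := pow_R1_Rle r0 n H; nra. }
split; first lra.
split.
- move=> r Hr f Hf; apply: (M_n_dilate_subordinate n beta) => //; first lra.
  have : r ^ n <= r0 ^ n by apply: pow_incr; lra.
  rewrite -/K; nra.
- move=> r1 Hr01 Hrad.
  have [f [Hf Ef]] := extremal_function n beta Hn Hbeta.
  have [_ [_ [w [_ [_ [Hw Ew]]]]]] := Hrad r1 ltac:(lra) f Hf.
  (* along the positive ray z f'/f reaches real values below 1 - 1/e *)
  set t := (r0 + r1) / 2.
  have Ht : r0 < t < r1 by rewrite /t; lra.
  have Htn : 1 < t ^ n * K.
  { have Hq : 1 < (t / r0) ^ n.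
    { apply: Rlt_pow_R1; last lia. apply/Rlt_div_r; lra. }
    have -> : t ^ n * K = (t / r0) ^ n * (r0 ^ n * K).
    { rewrite -Rmult_assoc -Rpow_mult_distr; congr (_ ^ _ * _); field; lra. }
    by rewrite Hr0n Rmult_1_r. }
  have Ht1 : t ^ n < 1 by apply: (proj2 (pow_lt_1_compat _ _ _ _)); [lra | lia].
  (* The test point is [t / r1], which the dilation by [r1] sends to [t]; choosing [t < r1] keeps it
     inside the disk. *)
  have Hx : in_disk (RtoC (t / r1)).
  { rewrite /in_disk Cmod_R Rabs_pos_eq; first by apply/Rlt_div_l; lra.
    apply: Rdiv_le_0_compat; lra. }
  have E := Ew _ Hx.
  rewrite (zf'f_dilate n) // in E; [|exact: (proj1 Hf) | lra].
  rewrite -RtoC_mult (_ : r1 * (t / r1) = t) in E; last by field; lra.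
  rewrite Ef in E; last by rewrite /in_disk Cmod_R Rabs_pos_eq; lra.
  have Hy : (w (RtoC (t / r1)) * cexp (w (RtoC (t / r1))) = RtoC (- (2 * (beta - 1) * t ^ n / (1 - t ^ n))))%C.
  { apply: (Cplus_eq_reg_l 1%C); rewrite -[LHS]E -RtoC_pow RtoC_opp RtoC_div ?RtoC_minus ?RtoC_mult; last lra.
    rewrite /Cdiv; ring. }
  have := lambert_real_bound _ _ (Hw _ Hx) Hy.
  (* Since [2 e (beta - 1) = K - 1], this is [t^n K > 1] rearranged; it contradicts the lower bound
     [-1/e] for real values. *)
  have : 1 < exp 1 * (2 * (beta - 1) * t ^ n / (1 - t ^ n)).
  { rewrite (_ : exp 1 * _ = (K - 1) * t ^ n / (1 - t ^ n)); last by rewrite /K; field; lra.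
    apply/Rlt_div_r; lra. }
  lra.
Qed.
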